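(* Let $g:\mathbb{C}\to\mathbb{C}$ be an entire function, let $\theta\in[0,e]$ be the ($z$-independent) constant $$\theta = e^{1-1/\rho} = \limsup_{n} \left|g^{(n)}(z)\right|^{\frac{1}{n\ln n}},$$ where $\rho\in[0,\infty]$ is the order of $g$, and for $z\in\mathbb{C}$ let $$\theta_0(z) = \limsup_{k} \left|g^{(2k)}(z)\right|^{\frac{1}{2k\ln k}},\qquad \theta_1(z) = \limsup_{k} \left|g^{(2k+1)}(z)\right|^{\frac{1}{2k\ln k}} .$$ Then $$\theta_0(z)=\theta \quad\text{and}\quad \theta_1(z)=\theta\qquad\text{for almost every } z\in\mathbb{C}$$ (with respect to Lebesgue area measure).
   Context: The order of an entire function $g$ is $\rho=\limsup_{r\to\infty}\frac{\ln\ln M(r)}{\ln r}\in[0,\infty]$, where $M(r)=\max_{|z|=r}|g(z)|$; equivalently, if $g(z)=\sum_{n\ge 0} a_n z^n$, then $\rho=\limsup_n \frac{n\ln n}{-\ln|a_n|}$ (terms with $a_n=0$ count as $0$, so polynomials, including $0$, have order $0$). The order is unchanged by translation $g(z)\mapsto g(z+z_0)$, and $\limsup_n |g^{(n)}(z)|^{1/(n\ln n)}$ has the same value $e^{1-1/\rho}$ for every $z\in\mathbb{C}$. Conventions: $e^{1-1/\rho}:=0$ if $\rho=0$ and $e^{1-1/\rho}:=e$ if $\rho=\infty$. *)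

(* Defs.v *)
From mathcomp Require Export all_boot all_order all_algebra.
From mathcomp Require Export all_classical all_reals all_analysis.
From mathcomp Require Export complex.
Set Implicit Arguments.
Unset Strict Implicit.
Unset Printing Implicit Defensive.
Import Order.TTheory GRing.Theory Num.Theory.
Import numFieldNormedType.Exports.
Local Open Scope classical_set_scope.
Local Open Scope ring_scope.
Local Open Scope complex_scope.

Section EntireFunctions.
Variable R : realType.
Implicit Types (g : R[i] -> R[i]) (z : R[i]) (n k : nat) (rho : \bar R).

(* [R[i]^o] is [R[i]] as a normed space over itself, so [derivable] and
   [derive1n] below are complex differentiation. *)
Definition entire g : Prop :=
  forall z, derivable (g : R[i]^o -> R[i]^o) z 1.

Definition cderiv n g : R[i] -> R[i] := derive1n n (g : R[i]^o -> R[i]^o).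

(* The norm of [R[i]] takes values in [R[i]]; [modulus] is its real part. *)
Definition modulus z : R := complex.Re `|z|.

Definition max_modulus g (r : R) : R :=
  sup [set modulus (g z) | z in [set z | modulus z = r]].

(* [ln] is 0 on nonpositive arguments, so constants (0 and the constants of
   modulus 1 included) get order 0. For nonconstant [g] the maximum modulus
   tends to +oo, and only arguments [> 0] matter in the upper limit. *)
Definition order_entire g : \bar R :=
  limf_esup (fun r : R => (ln (ln (max_modulus g r)) / ln r)%:E) +oo.

(* exp (1 - 1 / rho), with the values 0 at 0 and exp 1 at +oo; the case -oo
   is irrelevant, an order being nonnegative. *)
Definition theta_of_order rho : R :=
  match rho with
  | r%:E => if r == 0 then 0 else expR (1 - r^-1)
  | +oo%E => expR 1
  | -oo%E => 0
  end.

(* In the three upper limits below the exponents with index at most 1 divide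
   by 0; this affects finitely many terms only. *)
Definition theta_all g z : \bar R :=
  limn_esup (fun n => (modulus (cderiv n g z) `^ (n%:R * ln n%:R)^-1)%:E).

Definition theta_even g z : \bar R :=
  limn_esup (fun k =>
    (modulus (cderiv k.*2 g z) `^ (k.*2%:R * ln k%:R)^-1)%:E).

Definition theta_odd g z : \bar R :=
  limn_esup (fun k =>
    (modulus (cderiv k.*2.+1 g z) `^ (k.*2%:R * ln k%:R)^-1)%:E).

(* Lebesgue measure on the plane, carried by the identification of the pair
   [(x, y)] with [x +i* y]. *)
Definition ae_complex (P : R[i] -> Prop) : Prop :=
  {ae (@lebesgue_measure R \x @lebesgue_measure R)%E,
    forall p : R * R, P (p.1 +i* p.2)}.

End EntireFunctions.

(* Main.v *)
Require Import Defs.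
From mathcomp Require Import ring lra.
Import Order.TTheory GRing.Theory Num.Theory.
Import numFieldNormedType.Exports.
Local Open Scope classical_set_scope.
Local Open Scope ring_scope.
Local Open Scope complex_scope.
Set Implicit Arguments.
Unset Strict Implicit.
Unset Printing Implicit Defensive.

(** Write [L n = n ln n].  Everything is measured on the scale [expR (s * L n)],
    on which factors [C * K ^ n] are invisible.

    The value of [theta_all].  If the order is less than [lam], then
    [|g z| <= C * exp (|z| ^ lam)], and Cauchy's estimate on a circle of radius
    [n ^ (1 / lam)] gives [|g^(n) z| <= C * K ^ n * exp ((1 - 1 / lam) * L n)],
    uniformly for [z] in a disc ([log_bounded_of_growth]).  Conversely such a
    bound with exponent [s < 1] at a single point [z0] makes the Taylor series
    at [z0] grow at most like [exp (k * |w| ^ (1 / (1 - s)))]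
    ([growth_of_log_bounded]), so that the order is at most [1 / (1 - s)] and
    [theta <= exp s] ([theta_le_of_log_bounded]).  The two facts identify the
    upper limit over all [n] at every point, and the first one also gives
    [theta_even <= theta] and [theta_odd <= theta] everywhere.

    The lower bounds almost everywhere.  Suppose that on a set of positive
    measure the derivatives of one parity satisfy, from some index on,
    [|g^(2j+b)| <= exp (s * 2j ln j)] with [exp s < theta].  By Fubini's theorem
    a vertical line meets that set in a set [E] of positive length.  The
    function [f = g^(2j+b)] is small on [E] and, by the upper bound above, not
    too large on large discs: its Taylor polynomial of degree [N] at a point of
    the line is controlled on a disc by its values on [E], by interpolation at
    [N + 1] well separated points of [E] ([remez]), at the cost of a factor
    [K ^ N], while the remainder is as small as [(2 * K) ^ (- N)] if the larger
    disc is large enough.  With [N] proportional to [2j ln j] this improves the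
    bound on [f] in a disc to [exp (s' * 2j ln j)] with [exp s' < theta], as in
    a two-constants theorem ([two_constants], [slice_null]).  By Cauchy's
    estimate [f' = g^(2j+b+1)] obeys the same bound at the centre, so that all
    derivatives there do, of both parities: this contradicts
    [theta_le_of_log_bounded].

    The first half of the development supplies the function theory: a
    function differentiable at every point has primitives (Goursat), obeys
    Cauchy's estimate ([cauchy_estimate]), and has entire derivatives
    ([derivative_differentiable]). *)

(** * The modulus of a complex number *)

Section Modulus.
Variable R : realType.
Implicit Types (x y z w : R[i]) (a b r : R).

Lemma modulusE z : modulus z = Num.sqrt (complex.Re z ^+ 2 + complex.Im z ^+ 2).
Proof. by rewrite /modulus normc_def. Qed.

Lemma normr_modulus z : `|z| = (modulus z)%:C.
Proof. by rewrite modulusE normc_def. Qed.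

Lemma modulus_ge0 z : 0 <= modulus z.
Proof. by rewrite modulusE sqrtr_ge0. Qed.

Lemma modulus0 : modulus (0 : R[i]) = 0.
Proof. by rewrite /modulus normr0. Qed.

Lemma modulus_eq0 z : (modulus z == 0) = (z == 0).
Proof.
by rewrite -[RHS]normr_eq0 normr_modulus eq_complex /= eqxx andbT.
Qed.

Lemma modulus_gt0 z : (0 < modulus z) = (z != 0).
Proof. by rewrite lt_def modulus_ge0 modulus_eq0 andbT. Qed.

Lemma modulus_le0 z : modulus z <= 0 -> z = 0.
Proof.
by move=> h; apply/eqP; rewrite -modulus_eq0 eq_le h modulus_ge0.
Qed.

Lemma modulus1 : modulus (1 : R[i]) = 1.
Proof. by rewrite /modulus normr1. Qed.

Lemma modulusM z w : modulus (z * w) = modulus z * modulus w.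
Proof.
have := normrM z w; rewrite !normr_modulus -rmorphM => /eqP.
by rewrite eq_complex /= => /andP[/eqP-> _].
Qed.

Lemma modulusX z n : modulus (z ^+ n) = modulus z ^+ n.
Proof. by elim: n => [|n IH]; rewrite ?expr0 ?modulus1 // !exprS modulusM IH. Qed.

Lemma modulusV z : modulus z^-1 = (modulus z)^-1.
Proof.
have [->|z0] := eqVneq z 0; first by rewrite invr0 modulus0 invr0.
have m0 : modulus z != 0 by rewrite modulus_eq0.
by apply: (mulfI m0); rewrite -modulusM !divff // modulus1.
Qed.

Lemma modulusN z : modulus (- z) = modulus z.
Proof. by rewrite /modulus normrN. Qed.

Lemma modulusB z w : modulus (z - w) = modulus (w - z).
Proof. by rewrite -modulusN opprB. Qed.

Lemma modulusD z w : modulus (z + w) <= modulus z + modulus w.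
Proof. by have := ler_normD z w; rewrite !normr_modulus -rmorphD lecR. Qed.

Lemma modulus_subD z w : modulus (z - w) <= modulus z + modulus w.
Proof. by rewrite -(modulusN w) modulusD. Qed.

Lemma modulus_sub_ge z w : modulus z - modulus w <= modulus (z - w).
Proof. by rewrite lerBlDr; have := modulusD (z - w) w; rewrite subrK. Qed.

Lemma modulusC a : modulus a%:C = `|a|.
Proof. by rewrite modulusE /= expr0n /= addr0 sqrtr_sqr. Qed.

Lemma modulus_i : modulus ('i : R[i]) = 1.
Proof. by rewrite modulusE /= expr0n expr1n add0r sqrtr1. Qed.

Lemma modulus_nat n : modulus (n%:R : R[i]) = n%:R.
Proof. by rewrite -(rmorph_nat (real_complex R)) modulusC ger0_norm. Qed.

Lemma Re_le_modulus z : `|complex.Re z| <= modulus z.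
Proof. by rewrite modulusE -[leLHS]sqrtr_sqr ler_wsqrtr // lerDl sqr_ge0. Qed.

Lemma Im_le_modulus z : `|complex.Im z| <= modulus z.
Proof. by rewrite modulusE -[leLHS]sqrtr_sqr ler_wsqrtr // lerDr sqr_ge0. Qed.

Lemma complex_ReIm z : z = (complex.Re z)%:C + 'i * (complex.Im z)%:C.
Proof. by case: z => a b; apply/eqP; rewrite eq_complex /=; apply/andP; split; apply/eqP; ring. Qed.

Lemma realCD a b : (a + b)%:C = a%:C + b%:C :> R[i].
Proof. by rewrite rmorphD. Qed.

Lemma realCM a b : (a * b)%:C = a%:C * b%:C :> R[i].
Proof. by rewrite rmorphM. Qed.

Lemma realCX a n : (a ^+ n)%:C = a%:C ^+ n :> R[i].
Proof. by rewrite rmorphXn. Qed.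

Lemma ReD z w : complex.Re (z + w) = complex.Re z + complex.Re w.
Proof. by case: z; case: w. Qed.

Lemma ImD z w : complex.Im (z + w) = complex.Im z + complex.Im w.
Proof. by case: z; case: w. Qed.

Lemma ReN z : complex.Re (- z) = - complex.Re z.
Proof. by case: z. Qed.

Lemma ImN z : complex.Im (- z) = - complex.Im z.
Proof. by case: z. Qed.

Lemma modulus_le_ReIm z : modulus z <= `|complex.Re z| + `|complex.Im z|.
Proof.
rewrite {1}(complex_ReIm z); apply: (le_trans (modulusD _ _)).
by rewrite modulusM modulus_i mul1r !modulusC.
Qed.

Lemma modulus_sum (I : Type) (s : seq I) (P : pred I) (f : I -> R[i]) :
  modulus (\sum_(i <- s | P i) f i) <= \sum_(i <- s | P i) modulus (f i).
Proof.
elim/big_ind2: _ => //; first by rewrite modulus0.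
by move=> x a y b xa yb; apply: le_trans (modulusD _ _) (lerD xa yb).
Qed.

Lemma modulus_prod (I : Type) (s : seq I) (P : pred I) (f : I -> R[i]) :
  modulus (\prod_(i <- s | P i) f i) = \prod_(i <- s | P i) modulus (f i).
Proof.
elim/big_ind2: _ => //; first by rewrite modulus1.
by move=> x a y b <- <-; rewrite modulusM.
Qed.

End Modulus.

(** * Complex differentiability at a point *)

Section Cdiff.
Variable R : realType.
Implicit Types (f g : R[i] -> R[i]) (z w d h : R[i]).

(** The derivative as a linear approximation, with a real modulus: every estimate
    below is an inequality between real numbers. *)
Definition cdiff f z d := forall e : R, 0 < e -> exists2 r : R, 0 < r &
  forall h, modulus h < r -> modulus (f (z + h) - f z - d * h) <= e * modulus h.

Lemma cdiff_cst (c : R[i]) z : cdiff (fun=> c) z 0.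
Proof.
by move=> e e0; exists 1 => // h _; rewrite subrr mul0r subr0 modulus0 mulr_ge0 ?modulus_ge0 ?ltW.
Qed.

Lemma cdiff_id z : cdiff id z 1.
Proof.
move=> e e0; exists 1 => // h _.
by rewrite (_ : _ - _ = 0) ?modulus0 ?mulr_ge0 ?modulus_ge0 ?ltW //; ring.
Qed.

Lemma cdiffD f g z d1 d2 : cdiff f z d1 -> cdiff g z d2 ->
  cdiff (fun w => f w + g w) z (d1 + d2).
Proof.
move=> Hf Hg e e0; have e2 : 0 < e / 2 by rewrite divr_gt0.
have [r r0 H1] := Hf _ e2; have [s s0 H2] := Hg _ e2.
exists (Num.min r s); first by rewrite lt_min r0.
move=> h; rewrite lt_min => /andP[hr hs].
rewrite (_ : _ - _ = (f (z + h) - f z - d1 * h) + (g (z + h) - g z - d2 * h)); last by ring.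
apply: le_trans (modulusD _ _) _; have := H1 _ hr; have := H2 _ hs.
by set X := modulus _; set Y := modulus _ => A B; lra.
Qed.

Lemma cdiffZ f z d c : cdiff f z d -> cdiff (fun w => c * f w) z (c * d).
Proof.
move=> Hf e e0.
have c1 : 0 < modulus c + 1 by rewrite ltr_wpDl ?modulus_ge0.
have [r r0 H] := Hf (e / (modulus c + 1)) (divr_gt0 e0 c1).
exists r => // h /H {}H.
rewrite (_ : _ - _ = c * (f (z + h) - f z - d * h)); last by ring.
rewrite modulusM; apply: le_trans (_ : (modulus c + 1) * (e / (modulus c + 1) * modulus h) <= _).
  by rewrite ler_pM ?modulus_ge0 // lerDl.
by rewrite mulrA mulrCA divff ?mulr1 // gt_eqF.
Qed.

Lemma cdiffN f z d : cdiff f z d -> cdiff (fun w => - f w) z (- d).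
Proof.
move=> Hf e /Hf[r r0 H]; exists r => // h /H.
by rewrite -modulusN; congr (modulus _ <= _); ring.
Qed.

Lemma cdiffB f g z d1 d2 : cdiff f z d1 -> cdiff g z d2 ->
  cdiff (fun w => f w - g w) z (d1 - d2).
Proof. by move=> Hf Hg; apply: cdiffD => //; exact: cdiffN. Qed.

(** Differentiability at a point bounds the increments linearly there, which is
    what the product and chain rules need of their factors. *)
Lemma cdiff_lip f z d : cdiff f z d -> exists2 r : R, 0 < r & forall h,
  modulus h < r -> modulus (f (z + h) - f z) <= (modulus d + 1) * modulus h.
Proof.
move=> /(_ 1 ltr01)[r r0 H]; exists r => // h /H.
rewrite mulrDl -modulusM -lerBlDl.
by apply: le_trans; exact: modulus_sub_ge.
Qed.

Lemma cdiff_cont f z d : cdiff f z d -> forall e : R, 0 < e ->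
  exists2 r : R, 0 < r & forall h, modulus h < r -> modulus (f (z + h) - f z) <= e.
Proof.
move=> /cdiff_lip[r r0 H] e e0.
have c1 : 0 < modulus d + 1 by rewrite ltr_wpDl ?modulus_ge0.
exists (Num.min r (e / (modulus d + 1))); first by rewrite lt_min r0 divr_gt0.
move=> h; rewrite lt_min => /andP[/H A B]; apply: (le_trans A).
by rewrite -ler_pdivlMl // mulrC ltW.
Qed.

Lemma cdiffM f g z d1 d2 : cdiff f z d1 -> cdiff g z d2 ->
  cdiff (fun w => f w * g w) z (d1 * g z + f z * d2).
Proof.
move=> Hf Hg e e0.
have mz : 0 < modulus (g z) + 1 by rewrite ltr_wpDl ?modulus_ge0.
have mf : 0 < modulus (f z) + 1 by rewrite ltr_wpDl ?modulus_ge0.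
have md : 0 < modulus d1 + 1 by rewrite ltr_wpDl ?modulus_ge0.
have e3 : 0 < e / 3 by rewrite divr_gt0.
have [r1 r10 H1] := Hf _ (divr_gt0 e3 mz).
have [r2 r20 H2] := Hg _ (divr_gt0 e3 mf).
have [r3 r30 H3] := cdiff_lip Hf.
have [r4 r40 H4] := cdiff_cont Hg (divr_gt0 e3 md).
exists (Num.min (Num.min r1 r2) (Num.min r3 r4)); first by rewrite !lt_min r10 r20 r30.
move=> h; rewrite !lt_min => /andP[/andP[/H1 {}H1 /H2 {}H2] /andP[/H3 {}H3 /H4 {}H4]].
have -> : f (z + h) * g (z + h) - f z * g z - (d1 * g z + f z * d2) * h =
   (f (z + h) - f z - d1 * h) * g z + f z * (g (z + h) - g z - d2 * h) +
   (f (z + h) - f z) * (g (z + h) - g z) by ring.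
have E a : 0 < a -> e / 3 / a * modulus h * a = e / 3 * modulus h.
  by move=> a0; rewrite mulrAC divfK // gt_eqF.
apply: le_trans (modulusD _ _) _.
have A1 : modulus ((f (z + h) - f z - d1 * h) * g z) <= e / 3 * modulus h.
  by rewrite modulusM -(E _ mz) ler_pM ?modulus_ge0 // lerDl.
have A2 : modulus (f z * (g (z + h) - g z - d2 * h)) <= e / 3 * modulus h.
  by rewrite mulrC modulusM -(E _ mf) ler_pM ?modulus_ge0 // lerDl.
have A3 : modulus ((f (z + h) - f z) * (g (z + h) - g z)) <= e / 3 * modulus h.
  by rewrite modulusM -(E _ md) mulrC -mulrA [modulus h * _]mulrC ler_pM ?modulus_ge0.
apply: le_trans (lerD (modulusD _ _) A3) _.
apply: le_trans (lerD (lerD A1 A2) (lexx _)) _.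
by rewrite -!mulrDl ler_wpM2r ?modulus_ge0 //; lra.
Qed.

Lemma cdiff_comp f g z d1 d2 : cdiff g z d2 -> cdiff f (g z) d1 ->
  cdiff (fun w => f (g w)) z (d1 * d2).
Proof.
move=> Hg Hf e e0.
have md1 : 0 < modulus d1 + 1 by rewrite ltr_wpDl ?modulus_ge0.
have md2 : 0 < modulus d2 + 1 by rewrite ltr_wpDl ?modulus_ge0.
have e2 : 0 < e / 2 by rewrite divr_gt0.
have [r1 r10 H1] := Hg _ (divr_gt0 e2 md1).
have [r2 r20 H2] := cdiff_lip Hg.
have [r3 r30 H3] := Hf _ (divr_gt0 e2 md2).
exists (Num.min (Num.min r1 r2) (r3 / (modulus d2 + 1))).
  by rewrite !lt_min r10 r20 divr_gt0.
move=> h; rewrite !lt_min => /andP[/andP[/H1 {}H1 /H2 {}H2] h3].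
have {}H3 := H3 (g (z + h) - g z) _.
have k3 : modulus (g (z + h) - g z) < r3.
  by apply: le_lt_trans H2 _; rewrite mulrC -ltr_pdivlMr.
move: H3 => /(_ k3); rewrite subrKC => H3.
have -> : f (g (z + h)) - f (g z) - d1 * d2 * h =
  (f (g (z + h)) - f (g z) - d1 * (g (z + h) - g z)) +
  d1 * (g (z + h) - g z - d2 * h) by ring.
apply: le_trans (modulusD _ _) _.
have E a : 0 < a -> e / 2 / a * (a * modulus h) = e / 2 * modulus h.
  by move=> a0; rewrite mulrA divfK // gt_eqF.
have A1 : modulus (f (g (z + h)) - f (g z) - d1 * (g (z + h) - g z)) <= e / 2 * modulus h.
  apply: le_trans H3 _; rewrite -(E _ md2) ler_wpM2l //.
  by rewrite ltW // divr_gt0.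
have A2 : modulus (d1 * (g (z + h) - g z - d2 * h)) <= e / 2 * modulus h.
  by rewrite modulusM -(E _ md1) mulrCA ler_pM ?modulus_ge0 // lerDl.
by apply: le_trans (lerD A1 A2) _; rewrite -mulrDl; lra.
Qed.

Lemma cdiff_ext f g z d : f =1 g -> cdiff f z d -> cdiff g z d.
Proof. by move=> fg H e /H[r r0 {}H]; exists r => // h /H; rewrite !fg. Qed.

Lemma cdiff_shift f z d (a : R[i]) : cdiff f (z + a) d -> cdiff (fun w => f (w + a)) z d.
Proof. by move=> H e /H[r r0 {}H]; exists r => // h /H; rewrite (addrAC z h a). Qed.

End Cdiff.

(** * Relation with the topological derivative *)

Section Bridge.
Variable R : realType.
Implicit Types (f g : R[i] -> R[i]) (z w d h : R[i]).

Lemma cdiff_cvg f z d : cdiff f z d <->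
  (h^-1 *: ((f : R[i]^o -> R[i]^o) (h + z) - f z) @[h --> (0 : R[i]^o)^'] --> (d : R[i]^o)).
Proof.
split=> [H|H].
  apply/cvgrPdist_le => /= e; rewrite ltcE /= => /andP[/eqP ei e0].
  have [r r0 A] := H _ e0.
  exists r%:C; first by rewrite /= ltcR.
  move=> /= h; rewrite sub0r normrN normr_modulus ltcR => hr h0.
  have := A _ hr; rewrite normr_modulus (complexE e) ei mulr0 addr0 lecR.
  rewrite -(ler_pM2r (x := modulus h^-1)) ?modulus_gt0 ?invr_eq0 //.
  rewrite -modulusM modulusV mulfK ?modulus_eq0 // -modulusN => B.
  apply: le_trans B.
  rewrite le_eqVlt; apply/orP; left; apply/eqP; congr modulus.
  rewrite addrC [h + z]addrC /GRing.scale /=. by field.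
move=> e e0; move/cvgrPdist_le : H => /(_ e%:C); rewrite ltcR => /(_ e0) /=.
case=> r /= r0 A.
move: r0; rewrite ltcE /= => /andP[/eqP ri r0].
exists (complex.Re r) => // h hr.
have [->|h0] := eqVneq h 0.
  by rewrite addr0 subrr mulr0 subr0 modulus0 mulr0.
have := A h; rewrite /= sub0r normrN !normr_modulus lecR => B.
have {B} : modulus (d - h^-1 *: (f (h + z) - f z)) <= e.
  by apply: B => //; rewrite (complexE r) /= ri mulr0 addr0 ltcR.
rewrite -(ler_pM2r (x := modulus h)) ?modulus_gt0 // -modulusM.
rewrite -modulusN; congr (modulus _ <= _).
rewrite addrC [h + z]addrC /GRing.scale /=. by field.
Qed.

End Bridge.

(** * Subdivision of rectangles *)

Section Subdivision.
Variable R : realType.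
Variable P : R -> R -> R -> R -> Prop.
Hypothesis Pquad : forall x1 x2 y1 y2 : R, x1 <= x2 -> y1 <= y2 ->
  let x := (x1 + x2) / 2 in let y := (y1 + y2) / 2 in
  P x1 x y1 y -> P x x2 y1 y -> P x1 x y y2 -> P x x2 y y2 -> P x1 x2 y1 y2.

(** The corner of the first of the four quarters of the rectangle with corner [s]
    and sides [W / 2 ^ n] and [H / 2 ^ n] on which [P] fails; the last quarter is
    the default. *)
Let quarter (n : nat) (W H : R) (s : R * R) : R * R :=
  let w := W / 2 ^+ n.+1 in let h := H / 2 ^+ n.+1 in
  if `[< ~ P s.1 (s.1 + w) s.2 (s.2 + h) >] then s
  else if `[< ~ P (s.1 + w) (s.1 + w + w) s.2 (s.2 + h) >] then (s.1 + w, s.2)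
  else if `[< ~ P s.1 (s.1 + w) (s.2 + h) (s.2 + h + h) >] then (s.1, s.2 + h)
  else (s.1 + w, s.2 + h).

Fixpoint bad_corner (W H : R) (s : R * R) (n : nat) : R * R :=
  if n is m.+1 then quarter m W H (bad_corner W H s m) else s.

Lemma bad_cornerP (W H : R) s n : 0 <= W -> 0 <= H ->
  ~ P s.1 (s.1 + W) s.2 (s.2 + H) ->
  let c := bad_corner W H s n in
  ~ P c.1 (c.1 + W / 2 ^+ n) c.2 (c.2 + H / 2 ^+ n).
Proof.
move=> W0 H0 nP; elim: n => [|n IH] /=; first by rewrite expr0 !divr1.
move: IH; set c := bad_corner _ _ _ _ => /= IH; rewrite /quarter.
set w := W / 2 ^+ n.+1; set h := H / 2 ^+ n.+1.
have w2 : W / 2 ^+ n = w + w by rewrite /w exprS invfM; lra.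
have h2 : H / 2 ^+ n = h + h by rewrite /h exprS invfM; lra.
have w0 : 0 <= w by rewrite divr_ge0 // exprn_ge0.
have h0 : 0 <= h by rewrite divr_ge0 // exprn_ge0.
case: asboolP => // /contrapT A1.
case: asboolP => // /contrapT A2.
case: asboolP => // /contrapT A3 /= A4.
apply: IH; rewrite w2 h2.
have e1 : (c.1 + (c.1 + (w + w))) / 2 = c.1 + w by lra.
have e2 : (c.2 + (c.2 + (h + h))) / 2 = c.2 + h by lra.
apply: Pquad; rewrite ?e1 ?e2 ?addrA //; lra.
Qed.

Lemma bad_corner_step (W H : R) s n : 0 <= W -> 0 <= H ->
  let c := bad_corner W H s n in let c' := bad_corner W H s n.+1 in
  [/\ c.1 <= c'.1, c.2 <= c'.2,
    c'.1 + W / 2 ^+ n.+1 <= c.1 + W / 2 ^+ n &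
    c'.2 + H / 2 ^+ n.+1 <= c.2 + H / 2 ^+ n].
Proof.
move=> W0 H0 /=; set c := bad_corner _ _ _ _; rewrite /quarter.
set w := W / 2 ^+ n.+1; set h := H / 2 ^+ n.+1.
have w2 : W / 2 ^+ n = w + w by rewrite /w exprS invfM; lra.
have h2 : H / 2 ^+ n = h + h by rewrite /h exprS invfM; lra.
have w0 : 0 <= w by rewrite divr_ge0 // exprn_ge0.
have h0 : 0 <= h by rewrite divr_ge0 // exprn_ge0.
by rewrite w2 h2; do 3?[case: asboolP => _ /=]; split; lra.
Qed.

Lemma nested_point (a l : nat -> R) : (forall n, a n <= a n.+1) ->
  (forall n, a n.+1 + l n.+1 <= a n + l n) -> (forall n, 0 <= l n) ->
  exists x, forall n, a n <= x <= a n + l n.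
Proof.
move=> ai bd l0.
have am n m : (n <= m)%N -> a n <= a m.
  by move: n m; exact: (nondecreasing_seqP a).1.
have bm n m : (n <= m)%N -> a m + l m <= a n + l n.
  by move: n m; exact: (nonincreasing_seqP (fun n => a n + l n)).1.
have ab n m : a n <= a m + l m.
  case: (leqP n m) => [/am h|/ltnW/bm h].
    by apply: (le_trans h); rewrite lerDl.
  by apply: le_trans h; rewrite lerDl.
have hs : has_sup (range a).
  by split; [exists (a 0%N), 0%N|exists (a 0%N + l 0%N) => _ [n _ <-]].
exists (sup (range a)) => n; apply/andP; split.
  by apply: ub_le_sup; [exact: hs.2|exists n].
by apply: ge_sup; [exact: hs.1|move=> _ [m _ <-]].
Qed.

(** Compactness of rectangles in the form used throughout: a property that passes
    from the four quarters to the whole and holds for small rectangles around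
    each point holds everywhere.  Otherwise quartering yields nested rectangles on
    which it fails, and they shrink to a point at which it holds locally. *)
Lemma subdivision (X1 X2 Y1 Y2 : R) : X1 <= X2 -> Y1 <= Y2 ->
  (forall x y, X1 <= x <= X2 -> Y1 <= y <= Y2 -> exists2 d : R, 0 < d &
    forall x1 x2 y1 y2, X1 <= x1 -> x1 <= x -> x <= x2 -> x2 <= X2 ->
      Y1 <= y1 -> y1 <= y -> y <= y2 -> y2 <= Y2 ->
      x2 - x1 < d -> y2 - y1 < d -> P x1 x2 y1 y2) ->
  P X1 X2 Y1 Y2.
Proof.
move=> X12 Y12 Ploc; apply: contrapT => nP.
pose W := X2 - X1; pose H := Y2 - Y1.
have W0 : 0 <= W by rewrite subr_ge0.
have H0 : 0 <= H by rewrite subr_ge0.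
pose c := bad_corner W H (X1, Y1).
have cbad n : ~ P (c n).1 ((c n).1 + W / 2 ^+ n) (c n).2 ((c n).2 + H / 2 ^+ n).
  by apply: bad_cornerP => //=; rewrite !subrKC.
have st n := bad_corner_step (X1, Y1) n W0 H0.
have [x hx] : exists x, forall n, (c n).1 <= x <= (c n).1 + W / 2 ^+ n.
  apply: nested_point => n; [by case: (st n)|by case: (st n)|].
  by rewrite divr_ge0 // exprn_ge0.
have [y hy] : exists x, forall n, (c n).2 <= x <= (c n).2 + H / 2 ^+ n.
  apply: nested_point => n; [by case: (st n)|by case: (st n)|].
  by rewrite divr_ge0 // exprn_ge0.
have c1 n : X1 <= (c n).1 /\ (c n).1 + W / 2 ^+ n <= X2.
  elim: n => [|n [A B]]; first by rewrite /c /= expr0 divr1 /W; split; lra.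
  by case: (st n) => *; split; [apply: le_trans A _|apply: le_trans B].
have c2 n : Y1 <= (c n).2 /\ (c n).2 + H / 2 ^+ n <= Y2.
  elim: n => [|n [A B]]; first by rewrite /c /= expr0 divr1 /H; split; lra.
  by case: (st n) => *; split; [apply: le_trans A _|apply: le_trans B].
have [d d0 hd] : exists2 d : R, 0 < d &
    forall x1 x2 y1 y2, X1 <= x1 -> x1 <= x -> x <= x2 -> x2 <= X2 ->
      Y1 <= y1 -> y1 <= y -> y <= y2 -> y2 <= Y2 ->
      x2 - x1 < d -> y2 - y1 < d -> P x1 x2 y1 y2.
  apply: Ploc.
    by have := hx 0%N; have := c1 0%N; lra.
  by have := hy 0%N; have := c2 0%N; lra.
have small (a : R) : 0 <= a -> exists N, forall n, (N <= n)%N -> a / 2 ^+ n < d.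
  move=> a0; have [N hN] : exists N : nat, a / d < N%:R.
    by exists (Num.truncn (a / d)).+1; rewrite truncnS_gt.
  exists N => n Nn; rewrite ltr_pdivrMr ?exprn_gt0 // mulrC -ltr_pdivrMr //.
  apply: (lt_le_trans hN); apply: (@le_trans _ _ n%:R); first by rewrite ler_nat.
  by rewrite -natrX ler_nat ltnW // ltn_expl.
have [N1 h1] := small W W0; have [N2 h2] := small H H0.
pose n := maxn N1 N2.
have [A1 A2] := c1 n; have [B1 B2] := c2 n.
have /andP[] := hx n; have /andP[] := hy n => *.
apply: (cbad n); apply: hd => //.
  by rewrite addrAC subrr add0r h1 // leq_maxl.
by rewrite addrAC subrr add0r h2 // leq_maxr.
Qed.

End Subdivision.

(** * Complex functions of a real variable *)

Section RealLine.
Variable R : realType.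
Implicit Types (u v : R -> R[i]) (f F : R[i] -> R[i]) (t x y a b : R) (z w d : R[i]).

Definition rdiff u t d := forall e : R, 0 < e -> exists2 r : R, 0 < r &
  forall h : R, `|h| < r -> modulus (u (t + h) - u t - d * h%:C) <= e * `|h|.

Lemma rdiffB u v t d1 d2 : rdiff u t d1 -> rdiff v t d2 ->
  rdiff (fun s => u s - v s) t (d1 - d2).
Proof.
move=> Hf Hg e e0; have e2 : 0 < e / 2 by rewrite divr_gt0.
have [r r0 H1] := Hf _ e2; have [s s0 H2] := Hg _ e2.
exists (Num.min r s); first by rewrite lt_min r0.
move=> h; rewrite lt_min => /andP[hr hs].
rewrite (_ : _ - _ = (u (t + h) - u t - d1 * h%:C) - (v (t + h) - v t - d2 * h%:C)); last by ring.
apply: le_trans (modulus_subD _ _) _; have := H1 _ hr; have := H2 _ hs.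
by set X := modulus _; set Y := modulus _ => A B; lra.
Qed.

Lemma rdiff_line f z w t d : cdiff f (z + t%:C * w) d ->
  rdiff (fun s => f (z + s%:C * w)) t (d * w).
Proof.
move=> H e e0; have w1 : 0 < modulus w + 1 by rewrite ltr_wpDl ?modulus_ge0.
have [r r0 {}H] := H _ (divr_gt0 e0 w1).
exists (r / (modulus w + 1)); first by rewrite divr_gt0.
move=> h; rewrite ltr_pdivlMr // => hr.
have hw : modulus (h%:C * w) <= `|h| * (modulus w + 1).
  by rewrite modulusM modulusC ler_wpM2l // lerDl.
have := H (h%:C * w) (le_lt_trans hw hr).
rewrite rmorphD mulrDl addrA mulrA (mulrAC d h%:C w) => A; apply: le_trans A _.
apply: le_trans (ler_wpM2l _ hw) _; first by rewrite ltW // divr_gt0.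
by rewrite mulrCA divfK ?gt_eqF // mulrC.
Qed.

Lemma rdiff_real_line (c t : R) : rdiff (fun s => (c * s)%:C) t c%:C.
Proof.
move=> e e0; exists 1 => // h _.
have -> : (c * (t + h))%:C - (c * t)%:C - c%:C * h%:C = 0.
  by rewrite mulrDr realCD (rmorphM (real_complex R) c h); ring.
by rewrite modulus0 mulr_ge0 // ltW.
Qed.

(** Both sides are additive in the interval, so the inequality, weakened by
    [e * (b - a)], need only be checked on small intervals around each point. *)
Lemma mean_value_comparison u u' (phi phi' : R -> R) a b : a <= b ->
  (forall t, a <= t <= b -> rdiff u t (u' t)) ->
  (forall t, a <= t <= b -> rdiff (fun s => (phi s)%:C) t (phi' t)%:C) ->
  (forall t, a <= t <= b -> modulus (u' t) <= phi' t) ->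
  modulus (u b - u a) <= phi b - phi a.
Proof.
move=> ab du dphi u'phi'.
suff H e : 0 < e -> modulus (u b - u a) <= phi b - phi a + e * (b - a).
  have [->|/eqP ba] := eqVneq a b; first by rewrite !subrr modulus0.
  apply/ler_addgt0Pl => e e0; have ba0 : 0 < b - a by lra.
  apply: le_trans (H (e / (b - a)) _) _; first by rewrite divr_gt0.
  by rewrite divfK ?gt_eqF // addrC.
move=> e0.
apply: (@subdivision R (fun x1 x2 _ _ =>
   modulus (u x2 - u x1) <= phi x2 - phi x1 + e * (x2 - x1)) _ a b 0 0) => //.
  move=> x1 x2 y1 y2 _ _ x y /= A1 A2 _ _.
  rewrite -(subrKA (u x)); apply: le_trans (modulusD _ _) _.
  apply: le_trans (lerD A2 A1) _.
  by rewrite le_eqVlt; apply/orP; left; apply/eqP; ring.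
have e2 : 0 < e / 2 by rewrite divr_gt0.
move=> x y0 xab _; have [r1 r10 H1] := du x xab _ e2.
have [r2 r20 H2] := dphi x xab _ e2.
exists (Num.min r1 r2); first by rewrite lt_min r10.
move=> x1 x2 y1 y2 _ x1x xx2 _ _ _ _ _; rewrite lt_min => /andP[hr1 hr2] _.
have side h : `|h| < r1 -> modulus (u (x + h) - u x) <= (phi' x + e / 2) * `|h|.
  move=> /H1 A; rewrite mulrDl -lerBlDl.
  apply: le_trans A; apply: le_trans (modulus_sub_ge _ _).
  by rewrite lerB // modulusM modulusC ler_wpM2r // u'phi'.
have phi_side h : `|h| < r2 -> `|phi (x + h) - phi x - phi' x * h| <= e / 2 * `|h|.
  by move=> /H2; rewrite -rmorphM -!rmorphB modulusC.
have A1 := side (x1 - x); have A2 := side (x2 - x).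
have B1 := phi_side (x1 - x); have B2 := phi_side (x2 - x).
rewrite -(subrKA (u x)); apply: le_trans (modulusD _ _) _.
rewrite -(modulusN (u x - u x1)) opprB.
have a1 : `|x1 - x| = x - x1 by rewrite ler0_norm ?opprB //; lra.
have a2 : `|x2 - x| = x2 - x by rewrite ger0_norm //; lra.
move: A1 A2 B1 B2; rewrite !subrKC a1 a2 => A1 A2 B1 B2.
apply: le_trans (lerD (A2 _) (A1 _)) _; [lra|lra|].
have := B1 ltac:(lra); have := B2 ltac:(lra); rewrite !ler_norml.
move=> /andP[b1 _] /andP[_ b2].
lra.
Qed.

Lemma mean_value_rdiff u u' a b M : a <= b ->
  (forall t, a <= t <= b -> rdiff u t (u' t)) ->
  (forall t, a <= t <= b -> modulus (u' t) <= M) ->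
  modulus (u b - u a) <= M * (b - a).
Proof.
move=> ab du Mu; rewrite mulrBr.
apply: (@mean_value_comparison u u' (fun t => M * t) (fun=> M)) => // t _.
exact: rdiff_real_line.
Qed.

Lemma mean_value_rdiff_sym u u' M a b :
  (forall t, Num.min a b <= t <= Num.max a b -> rdiff u t (u' t)) ->
  (forall t, Num.min a b <= t <= Num.max a b -> modulus (u' t) <= M) ->
  modulus (u b - u a) <= M * `|b - a|.
Proof.
case: (leP a b) => ab du Mu.
  by rewrite ger0_norm ?subr_ge0 //; exact: mean_value_rdiff Mu.
rewrite modulusB distrC gtr0_norm ?subr_gt0 //.
by apply: mean_value_rdiff Mu => //; exact: ltW.
Qed.

Lemma mean_value f f' z w M :
  (forall t, 0 <= t <= 1 -> cdiff f (z + t%:C * w) (f' (z + t%:C * w))) ->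
  (forall t, 0 <= t <= 1 -> modulus (f' (z + t%:C * w)) <= M) ->
  modulus (f (z + w) - f z) <= M * modulus w.
Proof.
move=> df Mf.
have := @mean_value_rdiff (fun s => f (z + s%:C * w)) (fun s => f' (z + s%:C * w) * w)
   0 1 (M * modulus w) ler01.
rewrite subr0 mulr1 mul1r mul0r addr0; apply.
  by move=> t ht; apply: rdiff_line; exact: df.
by move=> t ht; rewrite modulusM ler_wpM2r ?modulus_ge0 // Mf.
Qed.

Lemma derivable_epsilon (F : R -> R) x : derivable F x 1 ->
  forall e : R, 0 < e -> exists2 r : R, 0 < r &
    forall h : R, `|h| < r -> `|F (x + h) - F x - derive1 F x * h| <= e * `|h|.
Proof.
move=> dF e e0.
have : h^-1 *: (F (h + x) - F x) @[h --> 0^'] --> derive1 F x.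
  rewrite derive1E /derive.
  move: dF; rewrite /derivable.
  have -> : (fun h : R => h^-1 *: ((F \o shift x) (h *: (1 : R)) - F x)) =
     (fun h => h^-1 *: (F (h + x) - F x)).
    by apply/funext => h /=; rewrite /GRing.scale /= mulr1.
  by [].
move/cvgrPdist_le => /(_ e e0)[r /= r0 A]; exists r => // h hr.
have [->|h0] := eqVneq h 0.
  by rewrite addr0 subrr mulr0 subr0 normr0 mulr0.
have := A h; rewrite /= sub0r normrN => /(_ hr h0).
rewrite -(ler_pM2r (x := `|h|)) ?normr_gt0 // -normrM -normrN.
congr (`|_| <= _); rewrite [h + x]addrC /GRing.scale /=.
move: (F _) (F _) => p q; by field.
Qed.

Lemma real_antiderivative (phi : R -> R) a : continuous phi ->
  exists Phi : R -> R, forall x, a < x -> forall e : R, 0 < e -> exists2 r : R, 0 < r &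
    forall h : R, `|h| < r -> `|Phi (x + h) - Phi x - phi x * h| <= e * `|h|.
Proof.
move=> cphi.
exists (fun x => \int[lebesgue_measure]_(t in `[a, x]) phi t) => x ax e e0.
have xu : x < x + 1 by rewrite ltrDl.
have int : lebesgue_measure.-integrable `[a, x + 1] (EFin \o phi).
  apply: continuous_compact_integrable; first exact: segment_compact.
  exact: continuous_subspaceT.
have /= [dF F'] := @continuous_FTC1_closed R phi a x (x + 1) xu int ax (cphi x).
by rewrite -F'; exact: derivable_epsilon.
Qed.

(** The fundamental theorem of calculus for each component.  Antiderivatives
    replace integrals along horizontal and vertical segments in what follows. *)
Lemma antiderivative u a :
  (forall (t e : R), 0 < e -> exists2 r : R, 0 < r & forall h : R, `|h| < r -> modulus (u (t + h) - u t) <= e) ->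
  exists U : R -> R[i], forall x, a < x -> rdiff U x (u x).
Proof.
move=> cu.
have cRe : continuous (fun t => complex.Re (u t)).
  move=> t; apply/cvgrPdist_le => e e0 /=; have [r r0 H] := cu t e e0.
  exists r => //= s st; have {}st : `|s - t| < r by rewrite distrC.
  have := H (s - t) st; rewrite subrKC modulusB; apply: le_trans.
  by rewrite -ReN -ReD; exact: Re_le_modulus.
have cIm : continuous (fun t => complex.Im (u t)).
  move=> t; apply/cvgrPdist_le => e e0 /=; have [r r0 H] := cu t e e0.
  exists r => //= s st; have {}st : `|s - t| < r by rewrite distrC.
  have := H (s - t) st; rewrite subrKC modulusB; apply: le_trans.
  by rewrite -ImN -ImD; exact: Im_le_modulus.
have [A hA] := real_antiderivative a cRe.
have [B hB] := real_antiderivative a cIm.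
exists (fun x => A x +i* B x) => x ax e e0.
have e2 : 0 < e / 2 by rewrite divr_gt0.
have [r r0 H1] := hA x ax _ e2; have [s s0 H2] := hB x ax _ e2.
exists (Num.min r s); first by rewrite lt_min r0.
move=> h; rewrite lt_min => /andP[/H1 {}H1 /H2 {}H2].
apply: le_trans (modulus_le_ReIm _) _.
case: (u x) H1 H2 => p q /= H1 H2.
rewrite !mulr0 subr0 add0r.
by apply: le_trans (lerD H1 H2) _; rewrite -mulrDl; lra.
Qed.

End RealLine.

(** * Goursat's theorem and primitives *)

Section Goursat.
Variable R : realType.
Implicit Types (f F : R[i] -> R[i]) (x y a b : R) (z w d : R[i]).

Lemma rdiff_hor f y x d : cdiff f (x +i* y) d -> rdiff (fun s => f (s +i* y)) x d.
Proof.
have E (s : R) : (s +i* y) = (0 +i* y) + s%:C * 1.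
  by apply/eqP; rewrite eq_complex /=; apply/andP; split; apply/eqP; ring.
move=> H; rewrite -[d]mulr1 (_ : (fun s => _) = fun s : R => f ((0 +i* y) + s%:C * 1)).
  by apply: rdiff_line; rewrite -E.
by apply/funext => s; rewrite -E.
Qed.

Lemma rdiff_ver f y x d : cdiff f (x +i* y) d -> rdiff (fun s => f (x +i* s)) y (d * 'i).
Proof.
have E (s : R) : (x +i* s) = x%:C + s%:C * 'i.
  by apply/eqP; rewrite eq_complex /=; apply/andP; split; apply/eqP; ring.
move=> H; rewrite (_ : (fun s => _) = fun s : R => f (x%:C + s%:C * 'i)).
  by apply: rdiff_line; rewrite -E.
by apply/funext => s; rewrite -E.
Qed.

Lemma modulus_le_box z w (X Y r : R) : `|complex.Re z - complex.Re w| <= X ->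
  `|complex.Im z - complex.Im w| <= Y -> X + Y <= r -> modulus (z - w) <= r.
Proof.
move=> hx hy; apply: le_trans; apply: le_trans (modulus_le_ReIm _) _.
by rewrite ReD ReN ImD ImN lerD.
Qed.

Variables (F F' : R[i] -> R[i]) (a : R).
Hypothesis dF : forall z, cdiff F z (F' z).
(* A y is a primitive of F along the horizontal line of ordinate y, B x a
   primitive of F dz along the vertical line of abscissa x *)
Variables A B : R -> R -> R[i].
Hypothesis dA : forall x y, a < x -> rdiff (A y) x (F (x +i* y)).
Hypothesis dB : forall x y, a < y -> rdiff (B x) y (F (x +i* y) * 'i).

(** The integral of [F] along the boundary of a rectangle, run counterclockwise. *)
Definition boundary x1 x2 y1 y2 :=
  (A y1 x2 - A y1 x1) + (B x2 y2 - B x2 y1)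
  - (A y2 x2 - A y2 x1) - (B x1 y2 - B x1 y1).

Lemma boundary_quad x1 x2 y1 y2 (x y : R) :
  boundary x1 x2 y1 y2 = boundary x1 x y1 y + boundary x x2 y1 y
    + boundary x1 x y y2 + boundary x x2 y y2.
Proof. by rewrite /boundary; ring. Qed.

(** Near [x +i* y] the function is affine up to [e * |w - p|]; the affine part has
    the primitive [q], whose increments cancel around the rectangle, and the
    rest contributes at most its size times the perimeter. *)
Lemma boundary_small x y (e : R) : a < x -> a < y -> 0 < e -> exists2 r : R, 0 < r &
  forall x1 x2 y1 y2, a < x1 -> a < y1 -> x1 <= x -> x <= x2 -> y1 <= y -> y <= y2 ->
    x2 - x1 < r -> y2 - y1 < r ->
    modulus (boundary x1 x2 y1 y2) <= e * (x2 - x1 + (y2 - y1)) ^+ 2.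
Proof.
move=> ax ay e0; have e2 : 0 < e / 2 by rewrite divr_gt0.
pose p := x +i* y; have [r r0 H] := dF p e2.
exists (r / 2); first by rewrite divr_gt0.
move=> x1 x2 y1 y2 ax1 ay1 x1x xx2 y1y yy2 hx hy.
set W := x2 - x1; set K := y2 - y1.
(* A primitive of the affine approximation of F at p. *)
pose q w := F p * (w - p) + F' p / 2 * ((w - p) * (w - p)).
have dq w : cdiff q w (F p + F' p * (w - p)).
  have di : cdiff (fun w => w - p) w (1 - 0) by apply: cdiffB; [exact: cdiff_id|exact: cdiff_cst].
  have := cdiffD (cdiffZ (F p) di) (cdiffZ (F' p / 2) (cdiffM di di)).
  by congr cdiff; field.
have near w : x1 <= complex.Re w <= x2 -> y1 <= complex.Im w <= y2 ->
    modulus (F w - (F p + F' p * (w - p))) <= e / 2 * (W + K).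
  move=> hw1 hw2.
  have wp : modulus (w - p) <= W + K.
    by apply: modulus_le_box (lexx _) => /=; rewrite ler_norml /W /K; lra.
  have := H (w - p) (le_lt_trans wp _); rewrite subrKC => B0.
  have {B0} : modulus (F w - F p - F' p * (w - p)) <= e / 2 * modulus (w - p).
    by apply: B0; rewrite /W /K; lra.
  rewrite -addrA -opprD => /le_trans; apply.
  by rewrite ler_wpM2l // ltW.
have hor t : y1 <= t <= y2 ->
    modulus (A t x2 - q (x2 +i* t) - (A t x1 - q (x1 +i* t))) <= e / 2 * (W + K) * W.
  move=> ht; apply: (@mean_value_rdiff R (fun s => A t s - q (s +i* t))
    (fun s => F (s +i* t) - (F p + F' p * (s +i* t - p)))); first by lra.
    move=> s hs; apply: rdiffB; first by apply: dA; lra.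
    by apply: (@rdiff_hor q); exact: dq.
  by move=> s hs; apply: near.
have ver t : x1 <= t <= x2 ->
    modulus (B t y2 - q (t +i* y2) - (B t y1 - q (t +i* y1))) <= e / 2 * (W + K) * K.
  move=> ht; apply: (@mean_value_rdiff R (fun s => B t s - q (t +i* s))
    (fun s => F (t +i* s) * 'i - (F p + F' p * (t +i* s - p)) * 'i)); first by lra.
    move=> s hs; apply: rdiffB; first by apply: dB; lra.
    by apply: (@rdiff_ver q); exact: dq.
  by move=> s hs; rewrite -mulrBl modulusM modulus_i mulr1; apply: near.
have x12 : x1 <= x2 by lra.
have y12 : y1 <= y2 by lra.
have := hor y1; have := hor y2; have := ver x1; have := ver x2.
rewrite !lexx x12 y12 => /(_ isT) V2 /(_ isT) V1 /(_ isT) H2 /(_ isT) H1.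
have -> : boundary x1 x2 y1 y2 =
   (A y1 x2 - q (x2 +i* y1) - (A y1 x1 - q (x1 +i* y1)))
   + (B x2 y2 - q (x2 +i* y2) - (B x2 y1 - q (x2 +i* y1)))
   - (A y2 x2 - q (x2 +i* y2) - (A y2 x1 - q (x1 +i* y2)))
   - (B x1 y2 - q (x1 +i* y2) - (B x1 y1 - q (x1 +i* y1))).
  by rewrite /boundary; ring.
apply: le_trans (modulus_subD _ _) _.
apply: le_trans (lerD (modulus_subD _ _) V1) _.
apply: le_trans (lerD (lerD (modulusD _ _) H2) (lexx _)) _.
apply: le_trans (lerD (lerD (lerD H1 V2) (lexx _)) (lexx _)) _.
by rewrite le_eqVlt; apply/orP; left; apply/eqP; field.
Qed.

(** The bound by [e * (width + height) ^ 2] is additive under quartering and holds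
    locally by [boundary_small]. *)
Lemma goursat x1 x2 y1 y2 : a < x1 -> a < y1 -> x1 <= x2 -> y1 <= y2 ->
  boundary x1 x2 y1 y2 = 0.
Proof.
move=> ax ay x12 y12; apply/eqP; rewrite -modulus_eq0; apply/eqP/le_anti.
rewrite modulus_ge0 andbT.
set S := (x2 - x1 + (y2 - y1)) ^+ 2.
suff H e : 0 < e -> modulus (boundary x1 x2 y1 y2) <= e * S.
  apply/ler_addgt0Pl => e e0; rewrite addr0.
  have S0 : 0 < S + 1 by rewrite ltr_wpDl // sqr_ge0.
  apply: le_trans (H (e / (S + 1)) _) _; first by rewrite divr_gt0.
  by rewrite -mulrA ler_piMr ?ltW // ltr_pdivrMl ?mulr1 // ltrDl.
move=> e0.
apply: (@subdivision R (fun x1 x2 y1 y2 =>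
  modulus (boundary x1 x2 y1 y2) <= e * (x2 - x1 + (y2 - y1)) ^+ 2)) => //.
  move=> u1 u2 v1 v2 _ _ u v H1 H2 H3 H4.
  rewrite (boundary_quad _ _ _ _ u v).
  apply: le_trans (modulusD _ _) _.
  apply: le_trans (lerD (modulusD _ _) H4) _.
  apply: le_trans (lerD (lerD (modulusD _ _) H3) (lexx _)) _.
  apply: le_trans (lerD (lerD (lerD H1 H2) (lexx _)) (lexx _)) _.
  by rewrite le_eqVlt; apply/orP; left; apply/eqP; rewrite /u /v; field.
move=> x y hx hy.
have [r r0 Hr] := @boundary_small x y e ltac:(lra) ltac:(lra) e0.
exists r => // u1 u2 v1 v2 *; apply: Hr => //; lra.
Qed.

Lemma goursat_all x1 x2 y1 y2 : a < x1 -> a < y1 -> a < x2 -> a < y2 ->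
  boundary x1 x2 y1 y2 = 0.
Proof.
move=> ax1 ay1 ax2 ay2.
have X u1 u2 v1 v2 : boundary u1 u2 v1 v2 = - boundary u2 u1 v1 v2.
  by rewrite /boundary; ring.
have Y u1 u2 v1 v2 : boundary u1 u2 v1 v2 = - boundary u1 u2 v2 v1.
  by rewrite /boundary; ring.
case: (leP x1 x2) => [hx|/ltW hx]; case: (leP y1 y2) => [hy|/ltW hy].
- exact: goursat.
- by rewrite Y goursat ?oppr0.
- by rewrite X goursat ?oppr0.
- by rewrite X Y goursat ?oppr0.
Qed.

(** The increment of the candidate from a fixed corner is taken along a horizontal
    and then a vertical side.  By [goursat_all] the increment from [z] to [z + h]
    is the one along the two sides issued from [z], where [F] is close to [F z]. *)
Lemma primitive_from_sides : exists P : R[i] -> R[i],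
  forall z, a < complex.Re z -> a < complex.Im z -> cdiff P z (F z).
Proof.
pose b := a + 1; have ab : a < b by rewrite ltrDl.
exists (fun z => A b (complex.Re z) +
  (B (complex.Re z) (complex.Im z) - B (complex.Re z) b)).
case=> x y /= ax ay e e0.
have e2 : 0 < e / 2 by rewrite divr_gt0.
have [r r0 Hr] := cdiff_cont (dF (x +i* y)) e2.
exists (Num.min r (Num.min (x - a) (y - a)) / 2).
  by rewrite divr_gt0 // !lt_min r0 !subr_gt0 ax ay.
case=> h k; set m := Num.min _ _ => hm.
have [m0 m1 m2] : [/\ m <= r, m <= x - a & m <= y - a].
  by rewrite /m !ge_min !lexx ?orbT.
have hh : `|h| <= modulus (h +i* k) by exact: (Re_le_modulus (h +i* k)).
have hk : `|k| <= modulus (h +i* k) by exact: (Im_le_modulus (h +i* k)).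
set M := modulus (h +i* k) in hm hh hk *.
have hh1 := ler_normlP _ _ hh; have hk1 := ler_normlP _ _ hk.
rewrite /=.
have near s t : Num.min x (x + h) <= s <= Num.max x (x + h) ->
    Num.min y (y + k) <= t <= Num.max y (y + k) ->
    modulus (F (s +i* t) - F (x +i* y)) <= e / 2.
  move=> hs ht.
  have sx : `|s - x| <= `|h|.
    case: (ltrgt0P h) hs => [?|?|->]; rewrite /Num.min /Num.max ?addr0 ?ltxx.
    - by case: ltP => ?; rewrite ler_norml; lra.
    - by case: ltP => ?; rewrite ler_norml; lra.
    - by rewrite ler_norml; lra.
  have ty : `|t - y| <= `|k|.
    case: (ltrgt0P k) ht => [?|?|->]; rewrite /Num.min /Num.max ?addr0 ?ltxx.
    - by case: ltP => ?; rewrite ler_norml; lra.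
    - by case: ltP => ?; rewrite ler_norml; lra.
    - by rewrite ler_norml; lra.
  rewrite -[s +i* t](subrKC (x +i* y)); apply: Hr.
  have st : modulus (s +i* t - (x +i* y)) <= `|h| + `|k|.
    by apply: modulus_le_box (lexx _) => /=.
  by apply: le_lt_trans st _; lra.
have -> : A b (x + h) + (B (x + h) (y + k) - B (x + h) b) - (A b x + (B x y - B x b)) - F (x +i* y) * (h +i* k) =
  (A y (x + h) - F (x +i* y) * (x + h)%:C - (A y x - F (x +i* y) * x%:C)) +
  (B (x + h) (y + k) - F (x +i* y) * 'i * (y + k)%:C - (B (x + h) y - F (x +i* y) * 'i * y%:C)).
  have := @goursat_all x (x + h) b y ax ab _ ay; rewrite /boundary => /(_ _)/eqP.
  have axh : a < x + h by case: hh1; lra.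
  move/(_ axh); rewrite (complex_ReIm (h +i* k)) /= !realCD => E.
  apply/eqP; rewrite -subr_eq0 -(eqP E); apply/eqP; ring.
have dl (c : R[i]) s : rdiff (fun s : R => c * s%:C) s c.
  move=> e' e'0; exists 1 => // u _.
  rewrite realCD (_ : _ - _ = 0) ?modulus0 ?mulr_ge0 // ?ltW //; ring.
have st1 : modulus (A y (x + h) - F (x +i* y) * (x + h)%:C - (A y x - F (x +i* y) * x%:C))
   <= e / 2 * `|x + h - x|.
  apply: (@mean_value_rdiff_sym R (fun s => A y s - F (x +i* y) * s%:C)
    (fun s => F (s +i* y) - F (x +i* y))).
    move=> s hs; apply: rdiffB => //; apply: dA.
    move: hs; rewrite /Num.min; case: ifP => _; case: hh1; lra.
  move=> s hs; apply: near => //.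
  by rewrite ge_min le_max !lexx.
have st2 : modulus (B (x + h) (y + k) - F (x +i* y) * 'i * (y + k)%:C - (B (x + h) y - F (x +i* y) * 'i * y%:C))
   <= e / 2 * `|y + k - y|.
  apply: (@mean_value_rdiff_sym R (fun s => B (x + h) s - F (x +i* y) * 'i * s%:C)
    (fun s => F ((x + h) +i* s) * 'i - F (x +i* y) * 'i)).
    move=> s hs; apply: rdiffB => //; apply: dB.
    move: hs; rewrite /Num.min; case: ifP => _; case: hk1; lra.
  move=> s hs; rewrite -mulrBl modulusM modulus_i mulr1; apply: near => //.
  by rewrite ge_min le_max !lexx !orbT.
apply: le_trans (modulusD _ _) _; apply: le_trans (lerD st1 st2) _.
rewrite !(addrAC _ _ (- _)) !subrr !add0r -mulrDr.
have -> : e * M = e / 2 * (M + M) by field.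
by rewrite ler_wpM2l ?(ltW e2) // lerD.
Qed.

End Goursat.

Lemma exists_primitive (R : realType) (F F' : R[i] -> R[i]) (a : R) :
  (forall z, cdiff F z (F' z)) -> exists P : R[i] -> R[i],
  forall z, a < complex.Re z -> a < complex.Im z -> cdiff P z (F z).
Proof.
move=> dF.
have cont_rdiff (u : R -> R[i]) (t : R) d : rdiff u t d -> forall e : R, 0 < e ->
   exists2 r : R, 0 < r & forall h : R, `|h| < r -> modulus (u (t + h) - u t) <= e.
  move=> /(_ 1 ltr01)[r r0 H] e e0.
  have c1 : 0 < modulus d + 1 by rewrite ltr_wpDl ?modulus_ge0.
  exists (Num.min r (e / (modulus d + 1))); first by rewrite lt_min r0 divr_gt0.
  move=> h; rewrite lt_min => /andP[/H A B].
  apply: (@le_trans _ _ ((modulus d + 1) * `|h|)).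
    rewrite mulrDl -lerBlDl; apply: le_trans A.
    by apply: le_trans (modulus_sub_ge _ _); rewrite modulusM modulusC.
  by rewrite -ler_pdivlMl // mulrC ltW.
have hA (y : R) : exists U : R -> R[i], forall x : R, a < x -> rdiff U x (F (x +i* y)).
  apply: (@antiderivative R (fun x => F (x +i* y))) => t e e0.
  exact: (cont_rdiff _ _ _ (rdiff_hor (dF (t +i* y))) e e0).
have hB (x : R) : exists U : R -> R[i], forall y : R, a < y -> rdiff U y (F (x +i* y) * 'i).
  apply: (@antiderivative R (fun y => F (x +i* y) * 'i)) => t e e0.
  have [r r0 H] := cont_rdiff _ _ _ (rdiff_ver (dF (x +i* t))) e e0.
  by exists r => // h /H; rewrite -mulrBl modulusM modulus_i mulr1.
have [A dA] := choice hA; have [B dB] := choice hB.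
by apply: (@primitive_from_sides R F F' a dF A B) => // x y; exact: dA.
Qed.

(** * The complex exponential *)

Section ComplexExponential.
Variable R : realType.
Implicit Types (z w : R[i]) (a b : R).

Definition cexp z : R[i] :=
  (expR (complex.Re z) * cos (complex.Im z)) +i* (expR (complex.Re z) * sin (complex.Im z)).

Lemma cexpD z w : cexp (z + w) = cexp z * cexp w.
Proof.
case: z w => [a b] [c d]; rewrite /cexp /= expRD cosD sinD.
by apply/eqP; rewrite eq_complex /=; apply/andP; split; apply/eqP; ring.
Qed.

Lemma cexp0 : cexp 0 = 1.
Proof. by rewrite /cexp /= expR0 cos0 sin0 mulr1 mulr0. Qed.

Lemma modulus_cexp z : modulus (cexp z) = expR (complex.Re z).
Proof.
rewrite modulusE /= !exprMn -mulrDr cos2Dsin2 mulr1 sqrtr_sqr ger0_norm //.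
Qed.

Lemma cexpK z : cexp z * cexp (- z) = 1.
Proof. by rewrite -cexpD subrr cexp0. Qed.

Lemma cexp_2pi a : cexp (a +i* (pi *+ 2)) = cexp (a +i* 0).
Proof. by rewrite /cexp /= sin2pi cos2pi sin0 cos0. Qed.

Lemma cdiff_cexp0 : cdiff cexp 0 1.
Proof.
move=> e e0.
pose k := Num.min (e / 8) 1.
have k0 : 0 < k by rewrite lt_min ltr01 divr_gt0.
have k1 : k <= 1 by rewrite ge_min lexx orbT.
have ke : k <= e / 8 by rewrite ge_min lexx.
clearbody k.
have [r1 r10 H1] := derivable_epsilon (@ex_derive _ _ _ _ _ _ _ (is_derive_expR (0 : R))) k0.
have [r2 r20 H2] := derivable_epsilon (@ex_derive _ _ _ _ _ _ _ (is_derive_cos (0 : R))) k0.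
have [r3 r30 H3] := derivable_epsilon (@ex_derive _ _ _ _ _ _ _ (is_derive_sin (0 : R))) k0.
exists (Num.min (Num.min r1 r2) (Num.min r3 k)); first by rewrite !lt_min r10 r20 r30 k0.
case=> a b; rewrite !lt_min; set m := modulus _ => /andP[/andP[h1 h2] /andP[h3 hk]].
have am : `|a| <= m by exact: (Re_le_modulus (a +i* b)).
have bm : `|b| <= m by exact: (Im_le_modulus (a +i* b)).
have := H1 a (le_lt_trans am h1); have := H2 b (le_lt_trans bm h2); have := H3 b (le_lt_trans bm h3).
rewrite !add0r !derive1E expR0 cos0 sin0.
rewrite (@derive_val _ _ _ _ _ _ _ (is_derive_cos (0 : R))).
rewrite (@derive_val _ _ _ _ _ _ _ (is_derive_sin (0 : R))).
rewrite (@derive_val _ _ _ _ _ _ _ (is_derive_expR (0 : R))).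
rewrite cos0 sin0 oppr0 mul0r !subr0 expR0 !mul1r addr0 => {}H3 {}H2 {}H1.
rewrite cexp0; apply: le_trans (modulus_le_ReIm _) _ => /=.
rewrite oppr0 !addr0.
have -> : expR a * cos b - 1 - a = (expR a - 1 - a) * cos b + (1 + a) * (cos b - 1) by ring.
have -> : expR a * sin b - b = (expR a - 1) * sin b + (sin b - b) by ring.
have a1 : `|a| <= k by rewrite (le_trans am) // ltW.
have c1 : `|(expR a - 1 - a) * cos b| <= k * `|a|.
  rewrite normrM -[leRHS]mulr1 ler_pM //.
  by rewrite ler_norml cos_geN1 cos_le1.
have c2 : `|(1 + a) * (cos b - 1)| <= 2 * (k * `|b|).
  rewrite normrM ler_pM //; apply: le_trans (ler_normD _ _) _.
  by rewrite normr1; lra.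
have ex : `|expR a - 1| <= 2 * k.
  rewrite -[expR a - 1](subrK a); apply: le_trans (ler_normD _ _) _.
  have : k * `|a| <= 1 * `|a| by rewrite ler_wpM2r.
  by lra.
have sx : `|sin b| <= 2 * `|b|.
  rewrite -[sin b](subrK b); apply: le_trans (ler_normD _ _) _.
  have : k * `|b| <= 1 * `|b| by rewrite ler_wpM2r.
  by lra.
have c3 : `|(expR a - 1) * sin b| <= 2 * k * (2 * `|b|) by rewrite normrM ler_pM.
apply: le_trans (lerD (ler_normD _ _) (ler_normD _ _)) _.
have A : k * `|a| <= k * m by rewrite ler_wpM2l // ltW.
have B : k * `|b| <= k * m by rewrite ler_wpM2l // ltW.
have C : k * m <= e / 8 * m by rewrite ler_wpM2r // modulus_ge0.
by lra.
Qed.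

Lemma cdiff_cexp z : cdiff cexp z (cexp z).
Proof.
have : cdiff (fun w => cexp z * cexp (w - z)) z (cexp z * 1).
  apply: cdiffZ; apply: (@cdiff_shift R cexp z 1 (- z)).
  by rewrite subrr; exact: cdiff_cexp0.
rewrite mulr1; apply: cdiff_ext => w.
by rewrite -cexpD subrKC.
Qed.

End ComplexExponential.

(** * Cauchy's estimate *)

Section CauchyEstimate.
Variable R : realType.
Implicit Types (f : R[i] -> R[i]) (z w a : R[i]) (r M : R).

(** In the coordinate [w] with [z = a + exp w], the function
    [F w = f (a + exp w) * exp (- w)] is entire and has period [2 i pi].  The
    increment over one period of a primitive of [F] is therefore the same on
    every vertical line: on [Re w = ln r] it is at most [2 pi M / r], and far to
    the left, where [F w] is close to [f a * exp (- w) + f' a], it is close to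
    [2 i pi * f' a]. *)
Lemma cauchy_estimate f f' a r M : (forall z, cdiff f z (f' z)) -> 0 < r ->
  (forall z, modulus (z - a) = r -> modulus (f z) <= M) ->
  modulus (f' a) <= M / r.
Proof.
move=> df r0 fM; apply/ler_addgt0Pl => e e0.
pose F w := f (a + cexp w) * cexp (- w).
have dN w : cdiff (fun w : R[i] => - w) w (- 1) by apply: cdiffN; exact: cdiff_id.
have dE w : cdiff (fun w : R[i] => cexp (- w)) w (cexp (- w) * - 1).
  exact: (cdiff_comp (dN w) (cdiff_cexp (- w))).
have dF w : cdiff F w (f' (a + cexp w) * (0 + cexp w) * cexp (- w)
    + f (a + cexp w) * (cexp (- w) * - 1)).
  apply: cdiffM => //; apply: (@cdiff_comp R f (fun w => a + cexp w)) => //.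
  by apply: cdiffD; [exact: cdiff_cst|exact: cdiff_cexp].
have [d d0 Hd] := df a e e0.
(* On the line of abscissa s the point a + exp w is within d of a. *)
pose s := Num.min (ln r) (ln (d / 2)).
have [P dP] := exists_primitive (Num.min s 0 - 1) dF.
have p0 : 0 <= pi *+ 2 :> R by rewrite mulrn_wge0 // pi_ge0.
have {}dP (x y : R) : s <= x -> 0 <= y -> cdiff P (x +i* y) (F (x +i* y)).
  have b1 : Num.min s 0 <= s by rewrite ge_min lexx.
  have b2 : Num.min s 0 <= 0 by rewrite ge_min lexx orbT.
  by move=> sx y0; apply: dP => /=; lra.
have cexpN2pi (x : R) : cexp (- (x +i* (pi *+ 2))) = cexp (- (x +i* 0)).
  have E : cexp (x +i* 0) != 0.
    by rewrite -modulus_eq0 modulus_cexp gt_eqF // expR_gt0.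
  by apply: (mulfI E); rewrite cexpK -cexp_2pi cexpK.
have F2pi (x : R) : F (x +i* (pi *+ 2)) = F (x +i* 0).
  by rewrite /F cexp_2pi cexpN2pi.
have period_cst : P (ln r +i* (pi *+ 2)) - P (ln r +i* 0) =
    P (s +i* (pi *+ 2)) - P (s +i* 0).
  apply/eqP; rewrite -subr_eq0; apply/eqP/modulus_le0.
  have sr : s <= ln r by rewrite ge_min lexx.
  rewrite -[leRHS](mul0r (ln r - s)).
  apply: (@mean_value_rdiff R (fun x => P (x +i* (pi *+ 2)) - P (x +i* 0))
     (fun x => F (x +i* (pi *+ 2)) - F (x +i* 0))) => //.
    by move=> x /andP[sx _]; apply: rdiffB; apply: rdiff_hor; exact: dP.
  by move=> x _; rewrite F2pi subrr modulus0.
have outer : modulus (P (ln r +i* (pi *+ 2)) - P (ln r +i* 0)) <= M / r * (pi *+ 2 - 0).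
  apply: (@mean_value_rdiff R (fun y => P (ln r +i* y)) (fun y => F (ln r +i* y) * 'i)) => //.
    move=> y /andP[y0 _]; apply: rdiff_ver; apply: dP => //.
    by rewrite ge_min lexx.
  move=> y _; rewrite modulusM modulus_i mulr1 /F modulusM modulus_cexp /= expRN lnK //.
  rewrite ler_pM2r ?invr_gt0 //; apply: fM.
  by rewrite addrAC subrr add0r modulus_cexp /= lnK.
(* A primitive of f a * exp (- w) + f' a, the leading part of F far to the left. *)
pose Q w := f' a * w - f a * cexp (- w).
have dQ w : cdiff Q w (f' a + f a * cexp (- w)).
  have := cdiffB (cdiffZ (f' a) (cdiff_id w)) (cdiffZ (f a) (dE w)).
  by congr cdiff; ring.
have inner : modulus ((P (s +i* (pi *+ 2)) - Q (s +i* (pi *+ 2))) - (P (s +i* 0) - Q (s +i* 0)))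
    <= e * (pi *+ 2 - 0).
  apply: (@mean_value_rdiff R (fun y => P (s +i* y) - Q (s +i* y))
    (fun y => F (s +i* y) * 'i - (f' a + f a * cexp (- (s +i* y))) * 'i)) => //.
    move=> y /andP[y0 _]; apply: rdiffB; apply: rdiff_ver => //.
    exact: dP.
  move=> y _; rewrite -mulrBl modulusM modulus_i mulr1 /F.
  set w := s +i* y.
  have -> : f (a + cexp w) * cexp (- w) - (f' a + f a * cexp (- w)) =
    (f (a + cexp w) - f a - f' a * cexp w) * cexp (- w).
    by rewrite !mulrBl -[_ * cexp w * _]mulrA cexpK; ring.
  have E0 : 0 < modulus (cexp w) by rewrite modulus_cexp expR_gt0.
  have Nw : modulus (cexp (- w)) = (modulus (cexp w))^-1.
    by rewrite !modulus_cexp ReN expRN.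
  rewrite modulusM Nw ler_pdivrMr //; apply: Hd.
  rewrite modulus_cexp /=; apply: (@le_lt_trans _ _ (expR (ln (d / 2)))).
    by rewrite ler_expR ge_min lexx orbT.
  by rewrite lnK ?posrE; lra.
have QE : Q (s +i* (pi *+ 2)) - Q (s +i* 0) = f' a * (0 +i* (pi *+ 2)).
  rewrite /Q cexpN2pi.
  have -> : s +i* (pi *+ 2) = (s +i* 0) + (0 +i* (pi *+ 2)).
    by apply/eqP; rewrite eq_complex /=; apply/andP; split; apply/eqP; ring.
  ring.
have p20 : 0 < pi *+ 2 :> R by rewrite mulrn_wgt0 // pi_gt0.
rewrite -(ler_pM2r p20).
have -> : modulus (f' a) * (pi *+ 2) = modulus (f' a * (0 +i* (pi *+ 2))).
  rewrite modulusM (modulusE (0 +i* _)) /= expr0n /= add0r sqrtr_sqr ger0_norm //.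
rewrite -QE; move: outer inner; rewrite subr0 period_cst => outer inner.
have -> : Q (s +i* (pi *+ 2)) - Q (s +i* 0) = (P (s +i* (pi *+ 2)) - P (s +i* 0))
   - ((P (s +i* (pi *+ 2)) - Q (s +i* (pi *+ 2))) - (P (s +i* 0) - Q (s +i* 0))) by ring.
apply: le_trans (modulus_subD _ _) _.
by rewrite mulrDl addrC lerD.
Qed.

End CauchyEstimate.

(** * The derivative of an entire function is entire *)

Section Regularity.
Variable R : realType.
Implicit Types (f : R[i] -> R[i]) (z w h : R[i]) (r e : R).

Lemma Re_Im_le z r : modulus z <= r ->
  - r <= complex.Re z <= r /\ - r <= complex.Im z <= r.
Proof.
move=> zr; split; rewrite -ler_norml; apply: le_trans zr.
  exact: Re_le_modulus.
exact: Im_le_modulus.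
Qed.

Lemma bounded_on_disc f f' r : (forall z, cdiff f z (f' z)) -> 0 <= r ->
  exists M, forall z, modulus z <= r -> modulus (f z) <= M.
Proof.
move=> df r0.
pose P x1 x2 y1 y2 := exists M, forall x y : R, x1 <= x <= x2 -> y1 <= y <= y2 ->
  modulus (f (x +i* y)) <= M.
have rr : - r <= r by lra.
have [M HM] : P (- r) r (- r) r.
  apply: subdivision => //.
    move=> x1 x2 y1 y2 _ _ x y [M1 H1] [M2 H2] [M3 H3] [M4 H4].
    exists (Num.max (Num.max M1 M2) (Num.max M3 M4)) => u v hu hv.
    have [ux|ux] := leP u x; have [vy|vy] := leP v y; rewrite !le_max.
    - by rewrite H1 //; lra.
    - by rewrite H3 ?orbT //; lra.
    - by rewrite H2 ?orbT //; lra.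
    - by rewrite H4 ?orbT //; lra.
  move=> x y _ _; have [d d0 H] := cdiff_cont (df (x +i* y)) ltr01.
  exists (d / 2); first by rewrite divr_gt0.
  move=> x1 x2 y1 y2 _ ? ? _ _ ? ? _ ? ?.
  exists (modulus (f (x +i* y)) + 1) => u v hu hv.
  rewrite -lerBlDl; apply: le_trans (modulus_sub_ge _ _) _.
  rewrite -[u +i* v](subrKC (x +i* y)); apply: H.
  apply: (@le_lt_trans _ _ (x2 - x1 + (y2 - y1))); last by lra.
  by apply: modulus_le_box (lexx _); rewrite /= ler_norml; lra.
by exists M => -[x y] /Re_Im_le[? ?]; exact: HM.
Qed.

Lemma uniformly_continuous_on_disc f f' r e : (forall z, cdiff f z (f' z)) ->
  0 <= r -> 0 < e -> exists2 d : R, 0 < d & forall z h, modulus z <= r ->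
  modulus h < d -> modulus (f (z + h) - f z) <= e.
Proof.
move=> df r0 e0.
pose P x1 x2 y1 y2 := exists2 d : R, 0 < d & forall (x y : R) h,
  x1 <= x <= x2 -> y1 <= y <= y2 -> modulus h < d ->
  modulus (f (x +i* y + h) - f (x +i* y)) <= e.
have rr : - r <= r by lra.
have [d d0 Hd] : P (- r) r (- r) r.
  apply: subdivision => //.
    move=> x1 x2 y1 y2 _ _ x y [d1 p1 H1] [d2 p2 H2] [d3 p3 H3] [d4 p4 H4].
    exists (Num.min (Num.min d1 d2) (Num.min d3 d4)).
      by rewrite !lt_min p1 p2 p3.
    move=> u v h hu hv; rewrite !lt_min => /andP[/andP[q1 q2] /andP[q3 q4]].
    have [ux|ux] := leP u x; have [vy|vy] := leP v y.
    - by apply: H1 => //; lra.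
    - by apply: H3 => //; lra.
    - by apply: H2 => //; lra.
    - by apply: H4 => //; lra.
  have e2 : 0 < e / 2 by rewrite divr_gt0.
  move=> x y _ _; have [d d0 H] := cdiff_cont (df (x +i* y)) e2.
  exists (d / 4); first by rewrite divr_gt0.
  move=> x1 x2 y1 y2 _ ? ? _ _ ? ? _ ? ?.
  exists (d / 2); first by rewrite divr_gt0.
  move=> u v h hu hv hh.
  rewrite -(subrKA (f (x +i* y))); apply: le_trans (modulusD _ _) _.
  have c : modulus (u +i* v - (x +i* y)) < d / 2.
    apply: (@le_lt_trans _ _ (x2 - x1 + (y2 - y1))); last by lra.
    by apply: modulus_le_box (lexx _); rewrite /= ler_norml; lra.
  rewrite [leRHS](splitr e); apply: lerD.
    rewrite -[u +i* v](subrKC (x +i* y)) -addrA; apply: H.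
    by apply: le_lt_trans (modulusD _ _) _; lra.
  rewrite modulusB -{1}[u +i* v](subrKC (x +i* y)); apply: H.
  by lra.
by exists d => // -[x y] h /Re_Im_le[? ?]; exact: Hd.
Qed.

(** Cauchy's estimate for the difference [f (w + h) - f w]. *)
Lemma derivative_uniformly_continuous f f' r e : (forall z, cdiff f z (f' z)) ->
  0 <= r -> 0 < e -> exists2 d : R, 0 < d & forall z h, modulus z <= r ->
  modulus h < d -> modulus (f' (z + h) - f' z) <= e.
Proof.
move=> df r0 e0.
have [d d0 Hd] := uniformly_continuous_on_disc df (addr_ge0 r0 ler01) e0.
exists d => // z h zr hd.
have -> : e = e / 1 by rewrite divr1.
apply: (@cauchy_estimate R (fun w => f (w + h) - f w) (fun w => f' (w + h) - f' w)) => //.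
  by move=> w; apply: cdiffB => //; exact: cdiff_shift.
move=> w wz; apply: Hd => //.
by rewrite -(subrK z w); apply: le_trans (modulusD _ _) _; rewrite wz addrC lerD2r.
Qed.

Lemma uniformly_differentiable f f' r e : (forall z, cdiff f z (f' z)) ->
  0 <= r -> 0 < e -> exists2 d : R, 0 < d & forall z h, modulus z <= r ->
  modulus h < d -> modulus (f (z + h) - f z - f' z * h) <= e * modulus h.
Proof.
move=> df r0 e0; have [d d0 Hd] := derivative_uniformly_continuous df r0 e0.
exists d => // z h zr hd.
have -> : f (z + h) - f z - f' z * h = f (z + h) - f' z * (z + h) - (f z - f' z * z).
  by ring.
apply: (@mean_value R (fun w => f w - f' z * w) (fun w => f' w - f' z * 1)).
  by move=> t _; apply: cdiffB => //; apply: cdiffZ; exact: cdiff_id.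
move=> t /andP[t0 t1]; rewrite mulr1; apply: Hd => //.
by rewrite modulusM modulusC ger0_norm //; apply: le_lt_trans hd; rewrite ler_piMl ?modulus_ge0.
Qed.

(** Cauchy's criterion for a limit at 0 of a function on the punctured plane. *)
Lemma real_limit0 (q : R[i] -> R) :
  (forall e, 0 < e -> exists2 d : R, 0 < d & forall h k, h != 0 -> k != 0 ->
    modulus h < d -> modulus k < d -> `|q h - q k| <= e) ->
  exists l, forall e, 0 < e -> exists2 d : R, 0 < d & forall h, h != 0 ->
    modulus h < d -> `|q h - l| <= e.
Proof.
move=> cq; pose t n : R[i] := (n.+1%:R^-1 : R)%:C.
have t0 n : t n != 0 by rewrite -modulus_eq0 modulusC normr_eq0 invr_eq0 pnatr_eq0.
have tN (d : R) : 0 < d -> exists N, forall n, (N <= n)%N -> modulus (t n) < d.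
  move=> d0; exists (Num.truncn d^-1) => n Nn.
  rewrite modulusC ger0_norm ?invr_ge0 // invf_plt ?posrE //.
  apply: (lt_le_trans (truncnS_gt _)); by rewrite ler_nat ltnS.
have : cvgn (fun n => q (t n)).
  apply/cauchy_cvgP/cauchy_exP => e e0.
  have e2 : 0 < e / 2 by rewrite divr_gt0.
  have [d d0 H] := cq _ e2; have [N HN] := tN d d0.
  exists (q (t N)); exists N => // n /= Nn.
  rewrite /ball /=; apply: (@le_lt_trans _ _ (e / 2)); last by lra.
  by apply: H; rewrite ?t0 // HN.
set l := limn _ => lc; exists l => e e0.
have e2 : 0 < e / 2 by rewrite divr_gt0.
have [d d0 H] := cq _ e2; have [N HN] := tN d d0.
exists d => // h h0 hd.
move/cvgrPdist_le: lc => /(_ _ e2)[N' _ /(_ (maxn N N'))] /=.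
rewrite leq_maxr => /(_ isT) A.
have := H h (t (maxn N N')) h0 (t0 _) hd (HN _ (leq_maxl _ _)) => B.
rewrite distrC in A.
rewrite -(subrKA (q (t (maxn N N')))); apply: le_trans (ler_normD _ _) _.
by rewrite [leRHS]splitr lerD.
Qed.

(** The difference quotients [Q h] converge to [f'] uniformly on a circle around
    [z], by [uniformly_differentiable].  Cauchy's estimate for [Q h - Q k] then
    shows that their derivatives at [z], which are the difference quotients of
    [f'], satisfy Cauchy's criterion. *)
Lemma derivative_differentiable f f' : (forall z, cdiff f z (f' z)) ->
  exists f'', forall z, cdiff f' z (f'' z).
Proof.
move=> df; suff H z : exists d, cdiff f' z d by have [f'' Hf] := choice H; exists f''.
pose q h := (f' (z + h) - f' z) / h.
have cq e : 0 < e -> exists2 d : R, 0 < d & forall h k, h != 0 -> k != 0 ->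
    modulus h < d -> modulus k < d -> modulus (q h - q k) <= e.
  move=> e0; have e2 : 0 < e / 2 by rewrite divr_gt0.
  have r0 : 0 <= modulus z + 1 by rewrite addr_ge0 ?modulus_ge0.
  have [d d0 Hd] := uniformly_differentiable df r0 e2.
  exists d => // h k h0 k0 hd kd.
  pose Q h w := (f (w + h) - f w) / h.
  have near v w : v != 0 -> modulus v < d -> modulus (w - z) = 1 ->
      modulus (Q v w - f' w) <= e / 2.
    move=> v0 vd wz; have wr : modulus w <= modulus z + 1.
      by rewrite -(subrK z w) addrC; apply: le_trans (modulusD _ _) _; rewrite wz.
    have := Hd w v wr vd; rewrite -(ler_pM2r (x := modulus v^-1)) ?modulus_gt0 ?invr_eq0 //.
    rewrite -modulusM modulusV mulfK ?modulus_eq0 //.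
    by congr (modulus _ <= _); rewrite /Q; field.
  rewrite -[e]divr1.
  apply: (@cauchy_estimate R (fun w => Q h w - Q k w)
    (fun w => (f' (w + h) - f' w) / h - (f' (w + k) - f' w) / k)) => //.
    have dQ v w : cdiff (Q v) w ((f' (w + v) - f' w) / v).
      rewrite mulrC; apply: (@cdiff_ext R (fun w => v^-1 * (f (w + v) - f w))).
        by move=> u; rewrite mulrC.
      by apply: cdiffZ; apply: cdiffB => //; exact: cdiff_shift.
    by move=> w; apply: cdiffB.
  move=> w wz; rewrite -(subrKA (f' w)) [leRHS]splitr.
  apply: le_trans (modulusD _ _) _; apply: lerD; first exact: near.
  by rewrite modulusB; exact: near.
have [lr Hr] : exists l, forall e, 0 < e -> exists2 d : R, 0 < d & forall h, h != 0 ->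
    modulus h < d -> `|complex.Re (q h) - l| <= e.
  apply: real_limit0 => e /cq[d d0 H]; exists d => // h k h0 k0 hd kd.
  by apply: le_trans (H h k h0 k0 hd kd); rewrite -ReN -ReD; exact: Re_le_modulus.
have [li Hi] : exists l, forall e, 0 < e -> exists2 d : R, 0 < d & forall h, h != 0 ->
    modulus h < d -> `|complex.Im (q h) - l| <= e.
  apply: real_limit0 => e /cq[d d0 H]; exists d => // h k h0 k0 hd kd.
  by apply: le_trans (H h k h0 k0 hd kd); rewrite -ImN -ImD; exact: Im_le_modulus.
exists (lr +i* li) => e e0; have e2 : 0 < e / 2 by rewrite divr_gt0.
have [d1 p1 H1] := Hr _ e2; have [d2 p2 H2] := Hi _ e2.
exists (Num.min d1 d2); first by rewrite lt_min p1.
move=> h; rewrite lt_min => /andP[h1 h2].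
have [->|h0] := eqVneq h 0.
  by rewrite addr0 subrr mulr0 subr0 modulus0 mulr0.
have -> : f' (z + h) - f' z - (lr +i* li) * h = (q h - (lr +i* li)) * h.
  by rewrite /q; field.
rewrite modulusM ler_wpM2r ?modulus_ge0 // [e]splitr.
by apply: modulus_le_box (lexx _) => /=; [exact: H1|exact: H2].
Qed.

End Regularity.

(** * Iterated derivatives *)

Section Derivatives.
Variable R : realType.
Implicit Types (g : R[i] -> R[i]) (z w : R[i]).

Lemma cdiff_derive1 g z d : cdiff g z d -> cderiv 1 g z = d.
Proof. by move/cdiff_cvg => H; rewrite /cderiv derive1n1 /derive1; exact: (cvg_lim _ H). Qed.

Lemma entire_cdiff g : entire g -> forall z, cdiff g z (cderiv 1 g z).
Proof.
move=> eg z; have := eg z; rewrite /derivable.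
have -> : (fun h : R[i]^o => h^-1 *: (((g : R[i]^o -> R[i]^o) \o shift z) (h *: (1 : R[i]^o)) - g z)) =
     (fun h : R[i]^o => h^-1 *: ((g : R[i]^o -> R[i]^o) (h + z) - g z)).
  by apply/funext => h /=; rewrite /GRing.scale /= mulr1.
move=> H; have /cdiff_cvg A := H.
by rewrite (cdiff_derive1 A).
Qed.

Lemma cdiff_cderiv g : entire g -> forall n z, cdiff (cderiv n g) z (cderiv n.+1 g z).
Proof.
move=> eg; elim=> [|n IH] z; first exact: entire_cdiff.
have [f'' H] := derivative_differentiable IH.
have := H z; congr cdiff; rewrite -(cdiff_derive1 (H z)).
by rewrite /cderiv derive1n1 -derive1nS.
Qed.

End Derivatives.

(** * Taylor polynomials *)

Section Taylor.
Variable R : realType.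
Implicit Types (z w a : R[i]) (r M : R).

Lemma cdiffX n z : cdiff (fun w : R[i] => w ^+ n) z (n%:R * z ^+ n.-1).
Proof.
elim: n => [|n IH].
  by rewrite mul0r; apply: (@cdiff_ext _ (fun=> 1)) (cdiff_cst _ _) => w; rewrite expr0.
apply: (@cdiff_ext _ (fun w => w * w ^+ n)); first by move=> w; rewrite exprS.
have := cdiffM (cdiff_id z) IH; congr cdiff => /=; case: n {IH} => [|n] /=.
  by rewrite expr0; ring.
by rewrite exprS -[n.+2%:R]natr1; ring.
Qed.

Lemma cdiff_sum (n : nat) (F F' : nat -> R[i] -> R[i]) z :
  (forall j, cdiff (F j) z (F' j z)) ->
  cdiff (fun w => \sum_(j < n) F j w) z (\sum_(j < n) F' j z).
Proof.
move=> dF; elim: n => [|n IH].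
  rewrite big_ord0; apply: (@cdiff_ext _ (fun=> 0)) (cdiff_cst _ _) => w.
  by rewrite big_ord0.
rewrite big_ord_recr /=; apply: (@cdiff_ext _ (fun w => \sum_(j < n) F j w + F n w)).
  by move=> w; rewrite big_ord_recr.
exact: cdiffD.
Qed.

(** The inductive step is [(1 + 1 / n) ^ n <= e]. *)
Lemma expn_le_fact_exp n : n%:R ^+ n <= n`!%:R * expR n%:R :> R.
Proof.
elim: n => [|n IH]; first by rewrite expr0 fact0 expR0 mulr1.
rewrite exprSr factS natrM -[X in expR X]natr1 expRD.
case: n IH => [|n] IH.
  by rewrite expr0 fact0 expR0 !mul1r; have := expR_ge1Dx (1 : R); lra.
have n0 : 0 < n.+1%:R :> R by rewrite ltr0n.
have A : n.+2%:R ^+ n.+1 <= n.+1%:R ^+ n.+1 * expR 1 :> R.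
  rewrite -ler_pdivrMl ?exprn_gt0 // mulrC -exprVn -exprMn.
  have -> : n.+2%:R / n.+1%:R = 1 + n.+1%:R^-1 :> R.
    by rewrite -[n.+2%:R]natr1 mulrDl divff ?gt_eqF // mul1r.
  apply: (@le_trans _ _ (expR n.+1%:R^-1 ^+ n.+1)).
    apply: lerXn2r; rewrite ?nnegrE ?expR_ge0 ?expR_ge1Dx //.
  by rewrite -expRM_natl divff ?gt_eqF.
have -> : n.+2%:R * n.+1`!%:R * (expR n.+1%:R * expR 1) =
  n.+1`!%:R * expR n.+1%:R * expR 1 * n.+2%:R :> R by ring.
rewrite ler_wpM2r ?ler0n //; apply: le_trans A _.
by rewrite ler_wpM2r ?expR_ge0.
Qed.

Variable D : nat -> R[i] -> R[i].
Hypothesis dD : forall n z, cdiff (D n) z (D n.+1 z).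

(** One circle of radius [rho] for each derivative. *)
Lemma cauchy_iterated m n a (rho M : R) : 0 < rho ->
  (forall z, modulus (z - a) <= n%:R * rho -> modulus (D m z) <= M) ->
  modulus (D (m + n) a) <= M / rho ^+ n.
Proof.
move=> rho0; elim: n a => [|n IH] a H.
  by rewrite addn0 expr0 divr1; apply: H; rewrite subrr modulus0 mul0r.
rewrite addnS exprSr invfM mulrA.
apply: (cauchy_estimate (@dD (m + n))) => // z za; apply: IH => w wz; apply: H.
rewrite -(subrKA z); apply: le_trans (modulusD _ _) _.
by rewrite za -natr1 mulrDl mul1r lerD2r.
Qed.

(** Spending the radius in [n] equal steps loses only a factor [e ^ n] against
    the sharp constant [n! / r ^ n]. *)
Lemma cauchy_derivatives m n a r M : 0 < r ->
  (forall z, modulus (z - a) <= r -> modulus (D m z) <= M) ->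
  modulus (D (m + n) a) <= M * (n%:R / r) ^+ n.
Proof.
move=> r0 H; case: n => [|n].
  by rewrite expr0 mulr1 addn0; apply: H; rewrite subrr modulus0 ltW.
have n0 : 0 < n.+1%:R :> R by rewrite ltr0n.
have := @cauchy_iterated m n.+1 a (r / n.+1%:R) M; rewrite -exprVn invf_div; apply.
  by rewrite divr_gt0.
by move=> z; rewrite mulrC divfK ?gt_eqF //; exact: H.
Qed.

Definition taylor m n a w := \sum_(j < n) D (m + j) a / j`!%:R * w ^+ j.

Lemma cdiff_taylor m n a w : cdiff (taylor m n.+1 a) w (taylor m.+1 n a w).
Proof.
have -> : taylor m.+1 n a w =
    \sum_(j < n.+1) D (m + j) a / j`!%:R * (j%:R * w ^+ j.-1).
  rewrite big_ord_recl mul0r mulr0 add0r; apply: eq_bigr => j _ /=.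
  rewrite /bump /= add1n addSnnS factS natrM invfM.
  have j0 : j.+1%:R != 0 :> R[i] by rewrite pnatr_eq0.
  have f0 : (j`!)%:R != 0 :> R[i] by rewrite pnatr_eq0 -lt0n fact_gt0.
  by field; rewrite f0 ?nat1r j0.
apply: (@cdiff_sum _ (fun j w => D (m + j) a / j`!%:R * w ^+ j)
   (fun j w => D (m + j) a / j`!%:R * (j%:R * w ^+ j.-1))) => j.
by apply: cdiffZ; exact: cdiffX.
Qed.

(** Integrate the bound for [D m.+1] along the segment from [a] to [a + w]. *)
Lemma taylor_remainder m n a w (S : R) :
  (forall t : R, 0 <= t <= 1 -> modulus (D (m + n) (a + t%:C * w)) <= S) ->
  modulus (D m (a + w) - taylor m n a w) <= S * modulus w ^+ n / n`!%:R.
Proof.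
elim: n m w => [|n IH] m w H.
  have := H 1; rewrite lexx ler01 => /(_ isT).
  by rewrite addn0 mul1r /taylor big_ord0 subr0 expr0 mulr1 fact0 divr1.
pose u (s : R) := D m (a + s%:C * w) - taylor m n.+1 a (0 + s%:C * w).
pose u' (s : R) := D m.+1 (a + s%:C * w) * w - taylor m.+1 n a (0 + s%:C * w) * w.
pose c := S * modulus w ^+ n.+1 / n.+1`!%:R.
have u0 : u 0 = 0.
  rewrite /u mul0r !addr0 /taylor big_ord_recl addn0 expr0 mulr1 fact0 divr1.
  by rewrite big1 ?addr0 ?subrr // => j _; rewrite exprS mul0r mulr0.
have u1 : u 1 = D m (a + w) - taylor m n.+1 a w by rewrite /u mul1r add0r.
rewrite -u1 -[u 1]subr0 -u0.
have -> : S * modulus w ^+ n.+1 / n.+1`!%:R = c * 1 ^+ n.+1 - c * 0 ^+ n.+1.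
  by rewrite expr1n expr0n /= mulr0 subr0 mulr1.
apply: (@mean_value_comparison R u u' (fun t => c * t ^+ n.+1)
  (fun t => c * (n.+1%:R * t ^+ n))) => //.
- by move=> t _; apply: rdiffB; apply: rdiff_line; [exact: dD|exact: cdiff_taylor].
- move=> t _.
  have := @rdiff_line R (fun w => c%:C * w ^+ n.+1) 0 1 t _ (cdiffZ c%:C (cdiffX n.+1 _)).
  rewrite add0r !mulr1 /=.
  have -> : (fun s : R => c%:C * (0 + s%:C * 1) ^+ n.+1) = (fun s => (c * s ^+ n.+1)%:C).
    by apply/funext => s; rewrite add0r mulr1 [RHS]realCM realCX.
  by congr rdiff; rewrite [RHS]realCM realCM realCX rmorph_nat.
- move=> t /andP[t0 t1]; rewrite /u' -mulrBl add0r modulusM.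
  have {IH}/IH A : forall s : R, 0 <= s <= 1 ->
      modulus (D (m.+1 + n) (a + s%:C * (t%:C * w))) <= S.
    move=> s /andP[s0 s1]; rewrite mulrA -rmorphM addSnnS; apply: H.
    by rewrite mulr_ge0 //= mulr_ile1.
  apply: le_trans (ler_wpM2r (modulus_ge0 _) A) _.
  rewrite modulusM modulusC ger0_norm // /c exprMn [modulus w ^+ n.+1]exprS factS natrM.
  have j0 : n.+1%:R != 0 :> R by rewrite pnatr_eq0.
  have f0 : (n`!)%:R != 0 :> R by rewrite pnatr_eq0 -lt0n fact_gt0.
  by rewrite le_eqVlt; apply/orP; left; apply/eqP; field; rewrite f0 ?nat1r j0.
Qed.

(** The derivative in the remainder is bounded by Cauchy's estimate on discs of
    radius [rho], and [n ^ n / n! <= e ^ n]. *)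
Lemma taylor_remainder_geometric m n a w r rho M : 0 < rho -> modulus w <= r ->
  (forall z, modulus (z - a) <= r + rho -> modulus (D m z) <= M) ->
  modulus (D m (a + w) - taylor m n a w) <= M * (expR 1 * r / rho) ^+ n.
Proof.
move=> rho0 wr H; have r0 : 0 <= r := le_trans (modulus_ge0 _) wr.
have M0 : 0 <= M.
  apply: le_trans (modulus_ge0 (D m a)) (H a _).
  by rewrite subrr modulus0 addr_ge0 // ltW.
have f0 : 0 < (n`!)%:R :> R by rewrite ltr0n fact_gt0.
have rn0 : 0 < rho ^+ n by rewrite exprn_gt0.
apply: le_trans (@taylor_remainder m n a w (M * (n%:R / rho) ^+ n) _) _.
  move=> t /andP[t0 t1]; apply: cauchy_derivatives => // z hz; apply: H.
  rewrite -(subrKA (a + t%:C * w)); apply: le_trans (modulusD _ _) _.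
  rewrite addrC lerD // addrAC subrr add0r modulusM modulusC ger0_norm //.
  by apply: le_trans wr; rewrite ler_piMl ?modulus_ge0.
rewrite -!mulrA ler_wpM2l // !exprMn exprVn -expRM_natl mulr1.
have -> : n%:R ^+ n / rho ^+ n * (modulus w ^+ n / n`!%:R) =
  (n%:R ^+ n / n`!%:R) * (modulus w ^+ n / rho ^+ n) by ring.
rewrite ler_pM ?divr_ge0 ?exprn_ge0 ?modulus_ge0 ?ler0n ?(ltW rn0) ?(ltW rho0) //.
  by rewrite ler_pdivrMr // mulrC expn_le_fact_exp.
by rewrite ler_pM2r ?invr_gt0 // lerXn2r ?nnegrE ?modulus_ge0.
Qed.

End Taylor.

(** * Size of the derivatives and growth *)

Section Growth.
Variable R : realType.
Implicit Types (z w : R[i]) (c k r s lam : R).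

Definition nlogn (n : nat) : R := n%:R * ln n%:R.

Lemma expR_nlogn n : expR (nlogn n) = n%:R ^+ n.
Proof.
case: n => [|n]; first by rewrite /nlogn mul0r expR0 expr0.
by rewrite /nlogn expRM_natl lnK // posrE ltr0n.
Qed.

Lemma nlogn_ge0 n : 0 <= nlogn n.
Proof.
case: n => [|n]; first by rewrite /nlogn mul0r.
by rewrite mulr_ge0 ?ler0n // ln_ge0 // ler1n.
Qed.

Lemma fact_ge_expR n : expR (nlogn n - n%:R) <= n`!%:R.
Proof.
by rewrite expRD expRN expR_nlogn ler_pdivrMr ?expR_gt0 // expn_le_fact_exp.
Qed.

Lemma le_of_geometric (a B M : R) : (forall n, a <= B + M * 2^-1 ^+ n) -> a <= B.
Proof.
move=> H; apply/ler_addgt0Pl => e e0.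
have [N hN] : exists N : nat, `|M| / e < N%:R.
  by exists (Num.truncn (`|M| / e)).+1; rewrite truncnS_gt.
apply: le_trans (H N) _; rewrite addrC lerD2r.
apply: (@le_trans _ _ (`|M| * 2^-1 ^+ N)).
  by rewrite ler_wpM2r ?ler_norm // exprn_ge0.
rewrite exprVn ler_pdivrMr ?exprn_gt0 // -ler_pdivrMl //.
rewrite mulrC; apply: le_trans (ltW hN) _.
by rewrite -natrX ler_nat ltnW // ltn_expl.
Qed.

Lemma sum_half_le n : \sum_(j < n) (2^-1 : R) ^+ j <= 2.
Proof.
suff -> : \sum_(j < n) (2^-1 : R) ^+ j = 2 - 2 * 2^-1 ^+ n.
  by rewrite gerBl mulr_ge0 // exprn_ge0.
elim: n => [|n IH]; first by rewrite big_ord0 expr0; ring.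
by rewrite big_ord_recr /= IH exprS; field.
Qed.

Variable D : nat -> R[i] -> R[i].
Hypothesis dD : forall n z, cdiff (D n) z (D n.+1 z).

(** [D n] is at most [C * K ^ n * n ^ (s n)], uniformly on discs. *)
Definition locally_log_bounded s := forall r, 0 <= r -> exists c k, forall n z,
  modulus z <= r -> modulus (D n z) <= expR (c + k * n%:R + s * nlogn n).

Lemma locally_log_bounded_le s t : s <= t ->
  locally_log_bounded s -> locally_log_bounded t.
Proof.
move=> st H r r0; have [c [k Hck]] := H r r0; exists c, k => n z zr.
apply: le_trans (Hck n z zr) _; rewrite ler_expR lerD2l.
by rewrite ler_wpM2r // nlogn_ge0.
Qed.

(** Cauchy's estimate with radius 1. *)
Lemma locally_log_bounded1 : locally_log_bounded 1.
Proof.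
move=> r r0; have [M HM] := bounded_on_disc (@dD 0) (addr_ge0 r0 ler01).
exists M, 0 => n z zr; rewrite mul0r addr0 mul1r expRD expR_nlogn.
apply: le_trans (cauchy_derivatives dD (m := 0) n (M := M) ltr01 _) _.
  move=> w wz; apply: HM; rewrite -(subrK z w) addrC.
  by apply: le_trans (modulusD _ _) _; rewrite lerD.
rewrite divr1 ler_wpM2r ?exprn_ge0 ?ler0n //.
by apply: le_trans (expR_ge1Dx M); rewrite lerDr.
Qed.

(** Cauchy's estimate with the radius [n ^ (1 / lam)], at which the growth
    factor [exp (radius ^ lam)] is only exponential in [n]. *)
Lemma log_bounded_of_growth lam c0 : 0 < lam ->
  (forall z, modulus (D 0 z) <= expR (c0 + modulus z `^ lam)) ->
  locally_log_bounded (1 - lam^-1).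
Proof.
move=> lam0 gr r r0.
exists (c0 + (2 * r) `^ lam + 2 `^ lam), (2 `^ lam) => n z zr.
(* This is n ^ (1 / lam), and 1 for n = 0. *)
pose rho := expR (ln n%:R / lam).
have rho0 : 0 < rho by rewrite expR_gt0.
have rho_lam : rho `^ lam <= n%:R + 1.
  rewrite /rho -expRM divfK ?gt_eqF //.
  case: n {rho rho0} => [|n]; first by rewrite ln0 // expR0 add0r.
  by rewrite lnK ?posrE ?ltr0n // lerDl.
apply: le_trans (cauchy_derivatives dD (m := 0) n
  (M := expR (c0 + (r + rho) `^ lam)) rho0 _) _.
  move=> w wz; apply: le_trans (gr w) _; rewrite ler_expR lerD2l.
  apply: ge0_ler_powR; rewrite ?nnegrE ?modulus_ge0 ?(ltW lam0) //.
    by rewrite addr_ge0 // ltW.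
  rewrite -(subrK z w) addrC; apply: le_trans (modulusD _ _) _.
  by rewrite lerD.
have A : (r + rho) `^ lam <= (2 * r) `^ lam + 2 `^ lam * (n%:R + 1).
  have [h|h] := leP r rho.
    apply: (@le_trans _ _ ((2 * rho) `^ lam)).
      apply: ge0_ler_powR; rewrite ?nnegrE ?(ltW lam0) //.
      - by rewrite addr_ge0 // ltW.
      - by rewrite mulr_ge0 // ltW.
      - by lra.
    rewrite powRM ?(ltW rho0) // ler_wpDl ?powR_ge0 //.
    by rewrite ler_wpM2l // powR_ge0.
  apply: (@le_trans _ _ ((2 * r) `^ lam)).
    apply: ge0_ler_powR; rewrite ?nnegrE ?(ltW lam0) //.
    - by rewrite addr_ge0 // ltW.
    - by rewrite mulr_ge0.
    - by lra.
  by rewrite lerDl mulr_ge0 ?powR_ge0 // addr_ge0.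
rewrite exprMn exprVn /rho -expRM_natl -expR_nlogn -expRN -!expRD ler_expR.
have -> : n%:R * (ln n%:R / lam) = nlogn n / lam by rewrite /nlogn mulrA.
lra.
Qed.

Lemma ln_le_sub1 (x : R) : 0 < x -> ln x <= x - 1.
Proof.
by move=> x0; have := expR_ge1Dx (ln x); rewrite lnK ?posrE //; lra.
Qed.

(** With [y = x ^ (1 / sg)] the left-hand side is [sg * (j * ln (y / j))], and
    [ln u <= u]. *)
Lemma log_optimum (sg x : R) j : 0 < sg -> 0 < x ->
  j%:R * ln x - sg * nlogn j <= sg * x `^ sg^-1.
Proof.
move=> sg0 x0; have y0 : 0 < x `^ sg^-1 by rewrite powR_gt0.
case: j => [|j]; first by rewrite /nlogn !mul0r mulr0 subr0 mulr_ge0 ?ltW.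
have j0 : 0 < j.+1%:R :> R by rewrite ltr0n.
have -> : ln x = sg * ln (x `^ sg^-1) by rewrite ln_powR mulrA divff ?gt_eqF // mul1r.
rewrite /nlogn mulrCA -mulrBr -mulrBr ler_wpM2l ?(ltW sg0) //.
rewrite -ln_div ?posrE // -ler_pdivlMl // mulrC.
have v0 : 0 < j.+1%:R^-1 * x `^ sg^-1 by rewrite mulr_gt0 ?invr_gt0.
by apply: le_trans (ln_le_sub1 v0) _; rewrite gerBl ler01.
Qed.

(** The [j]-th Taylor term at distance [|w|] is, up to [2 ^ (- j)],
    [x ^ j * exp (- (1 - s) * j ln j)] with [x] proportional to [|w| + 1], and
    [log_optimum] bounds it independently of [j]. *)
Lemma growth_of_log_bounded z0 c k s : s < 1 ->
  (forall n, modulus (D n z0) <= expR (c + k * n%:R + s * nlogn n)) ->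
  exists c' k', 0 <= k' /\ forall w,
    modulus (D 0 (z0 + w)) <= expR (c' + k' * (modulus w + 1) `^ (1 - s)^-1).
Proof.
move=> s1 H; pose sg := 1 - s; have sg0 : 0 < sg by rewrite subr_gt0.
(* The factor 2 is spent on making the series geometric, the 1 in the exponent on
   comparing j! with j ^ j. *)
pose q := 2 * expR (k + 1); have q0 : 0 < q by rewrite mulr_gt0 // expR_gt0.
exists (c + ln 2), (sg * q `^ sg^-1); split.
  by rewrite mulr_ge0 ?powR_ge0 // ltW.
move=> w; rewrite -/sg; set W := modulus w + 1.
have W0 : 0 < W by rewrite ltr_wpDl ?modulus_ge0.
have x0 : 0 < q * W by rewrite mulr_gt0.
set y := (q * W) `^ sg^-1.
have yE : q `^ sg^-1 * W `^ sg^-1 = y by rewrite /y powRM // ltW.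
rewrite -mulrA yE.
have term j : modulus (D (0 + j) z0 / j`!%:R * w ^+ j) <= expR (c + sg * y) * 2^-1 ^+ j.
  rewrite add0n !modulusM modulusV modulus_nat modulusX.
  apply: (@le_trans _ _ (expR (c + k * j%:R + s * nlogn j) * expR (- (nlogn j - j%:R)) * W ^+ j)).
    apply: ler_pM; rewrite ?mulr_ge0 ?modulus_ge0 ?invr_ge0 ?exprn_ge0 ?modulus_ge0 //.
      apply: ler_pM; rewrite ?modulus_ge0 ?invr_ge0 //.
      rewrite expRN lef_pV2 ?posrE ?expR_gt0 ?ltr0n ?fact_gt0 //.
      exact: fact_ge_expR.
    by rewrite lerXn2r ?nnegrE ?modulus_ge0 ?(ltW W0) // lerDl.
  have opt := log_optimum j sg0 x0; rewrite -/y in opt.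
  have WE : W ^+ j = expR (j%:R * ln (q * W)) * expR (- ((k + 1) * j%:R)) * 2^-1 ^+ j.
    rewrite expRM_natl lnK ?posrE // -mulNr expRM_natr -!exprMn; congr (_ ^+ _).
    by rewrite /q expRN; field; rewrite gt_eqF // expR_gt0.
  rewrite WE mulrA ler_wpM2r ?exprn_ge0 // -!expRD ler_expR.
  rewrite /sg in opt *; lra.
have T n : modulus (taylor D 0 n z0 w) <= expR (c + ln 2 + sg * y).
  apply: le_trans (modulus_sum _ _ _) _.
  apply: (@le_trans _ _ (\sum_(j < n) expR (c + sg * y) * 2^-1 ^+ j)).
    by apply: ler_sum => j _; exact: term.
  rewrite -mulr_sumr addrAC [leRHS]expRD lnK ?posrE //.
  by rewrite ler_wpM2l ?expR_ge0 // sum_half_le.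
(* With this radius the Taylor remainders decrease like 2 ^ (- n). *)
pose rho := 2 * expR 1 * modulus w + 1.
have rho0 : 0 < rho.
  by rewrite ltr_wpDl // mulr_ge0 ?modulus_ge0 // mulr_ge0 // expR_ge0.
have [M HM] := bounded_on_disc (@dD 0)
  (addr_ge0 (modulus_ge0 z0) (addr_ge0 (modulus_ge0 w) (ltW rho0))).
apply: (@le_of_geometric _ _ M) => n.
rewrite -(subrK (taylor D 0 n z0 w) (D 0 _)) addrC.
apply: le_trans (modulusD _ _) _; apply: lerD => //.
apply: le_trans (taylor_remainder_geometric dD n (m := 0) (M := M) rho0 (lexx (modulus w)) _) _.
  move=> z hz; apply: HM; rewrite -(subrK z0 z) addrC.
  by apply: le_trans (modulusD _ _) _; rewrite lerD2l.
have M0 : 0 <= M.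
  apply: le_trans (modulus_ge0 (D 0 0)) (HM 0 _).
  rewrite modulus0; apply: addr_ge0; first exact: modulus_ge0.
  by apply: addr_ge0; [exact: modulus_ge0|exact: ltW].
rewrite ler_wpM2l // lerXn2r ?nnegrE ?divr_ge0 ?mulr_ge0 ?expR_ge0 ?modulus_ge0 ?(ltW rho0) //.
by rewrite ler_pdivrMr // /rho; lra.
Qed.

End Growth.

(** * Order *)

Section Order.
Variable R : realType.
Implicit Types (z w : R[i]) (c k r s lam e : R).

Section LimSup.
Local Open Scope ereal_scope.

Lemma limf_esup_pinfty_lt (f : R -> \bar R) (x : \bar R) :
  limf_esup f +oo%R < x -> exists (r : R) (y : \bar R), y < x /\
  forall t : R, (r < t)%R -> f t <= y.
Proof.
rewrite /limf_esup => /ereal_inf_lt[_ [A [r [_ rA]] <-] Ax].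
exists r, (ereal_sup [set f t | t in A]); split => // t rt.
by apply: ereal_sup_ubound; exists t => //; exact: rA.
Qed.

Lemma limf_esup_pinfty_le (f : R -> \bar R) (x : \bar R) (r : R) :
  (forall t : R, (r < t)%R -> f t <= x) -> limf_esup f +oo%R <= x.
Proof.
move=> H; rewrite /limf_esup.
apply: (@le_trans _ _ (ereal_sup [set f t | t in [set t | (r < t)%R]])).
  apply: ereal_inf_lbound; exists [set t | (r < t)%R] => //.
  by exists r; split => //; exact: num_real.
by apply: ge_ereal_sup => _ [t rt <-]; exact: H.
Qed.

Lemma limn_esup_lt (u : nat -> \bar R) (x : \bar R) :
  limn_esup u < x -> exists N, forall n, (N <= n)%N -> u n < x.
Proof.
rewrite /limn_esup /limf_esup => /ereal_inf_lt[_ [A [N _ NA] <-] Ax].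
exists N => n Nn; apply: le_lt_trans Ax.
by apply: ereal_sup_ubound; exists n => //; exact: NA.
Qed.

Lemma limn_esup_le (u : nat -> \bar R) (x : \bar R) N :
  (forall n, (N <= n)%N -> u n <= x) -> limn_esup u <= x.
Proof.
move=> H; rewrite /limn_esup /limf_esup.
apply: (@le_trans _ _ (ereal_sup [set u t | t in [set n | (N <= n)%N]])).
  apply: ereal_inf_lbound; exists [set n | (N <= n)%N] => //.
  by exists N.
by apply: ge_ereal_sup => _ [t rt <-]; exact: H.
Qed.

End LimSup.

Variables (g g' : R[i] -> R[i]).
Hypothesis dg : forall z, cdiff g z (g' z).

Lemma le_max_modulus z : modulus (g z) <= max_modulus g (modulus z).
Proof.
have [M HM] := bounded_on_disc dg (modulus_ge0 z).
apply: ub_le_sup; last by exists z.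
by exists M => _ [w /= wz <-]; apply: HM; rewrite wz.
Qed.

Lemma max_modulus_le r M : 0 <= r ->
  (forall z, modulus z = r -> modulus (g z) <= M) -> max_modulus g r <= M.
Proof.
move=> r0 H; apply: ge_sup; last by move=> _ [z /= zr <-]; exact: H.
by exists (modulus (g r%:C)), r%:C => //=; rewrite modulusC ger0_norm.
Qed.

Lemma ln_le (x y : R) : 0 < x -> x <= y -> ln x <= ln y.
Proof. by move=> x0 xy; rewrite ler_ln // posrE // (lt_le_trans x0). Qed.

Lemma le_expR_ln (x : R) : 0 <= x -> x <= expR (ln x).
Proof.
by rewrite le_eqVlt => /orP[/eqP<-|x0]; rewrite ?expR_ge0 // lnK.
Qed.

(** Beyond some radius the definition of the order gives the bound without a
    constant; the constant absorbs the disc inside. *)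
Lemma growth_of_order lam : 0 < lam -> (order_entire g < lam%:E)%E ->
  exists c, forall z, modulus (g z) <= expR (c + modulus z `^ lam).
Proof.
move=> lam0 /limf_esup_pinfty_lt[r0 [y [ylam Hy]]].
pose r := Num.max r0 (expR 1).
have r1 : expR 1 <= r by rewrite le_max lexx orbT.
have rr0 : r0 <= r by rewrite le_max lexx.
have rpos : 0 < r := lt_le_trans (expR_gt0 _) r1.
have [M HM] := bounded_on_disc dg (ltW rpos).
exists `|M| => z; have [zr|zr] := leP (modulus z) r.
  apply: le_trans (HM z zr) _; apply: le_trans (ler_norm _) _.
  apply: (@le_trans _ _ (expR `|M|)).
    by apply: le_trans (expR_ge1Dx _); rewrite lerDr.
  by rewrite ler_expR lerDl powR_ge0.
have z0 : 0 < modulus z := lt_trans rpos zr.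
apply: le_trans (le_max_modulus z) _.
set m := max_modulus _ _.
have m0 : 0 <= m := le_trans (modulus_ge0 _) (le_max_modulus z).
apply: le_trans (le_expR_ln m0) _; rewrite ler_expR.
apply: (@le_trans _ _ (modulus z `^ lam)); last by rewrite lerDr.
have [h|h] := leP (ln m) 0; first by rewrite (le_trans h) // powR_ge0.
have lz : 0 < ln (modulus z).
  by rewrite ln_gt0 // (le_lt_trans _ zr) // (le_trans _ r1) // -expR0 ler_expR.
have := le_lt_trans (Hy _ (le_lt_trans rr0 zr)) ylam.
rewrite lte_fin ltr_pdivrMr // -/m => A.
rewrite -(lnK (x := ln m)) ?posrE // /powR gt_eqF // ler_expR.
exact: ltW.
Qed.

Lemma order_le_of_growth mu c k : 0 < mu -> 0 <= k ->
  (forall z, modulus (g z) <= expR (c + k * (modulus z + 1) `^ mu)) ->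
  (order_entire g <= mu%:E)%E.
Proof.
move=> mu0 k0 H; apply/lee_addgt0Pr => e e0; rewrite -EFinD.
pose C := (`|c| + k + 1) * 2 `^ mu.
have C0 : 0 < C by rewrite mulr_gt0 ?powR_gt0 // ltr_wpDl // addr_ge0.
pose r := Num.max (expR 1) (expR (ln C / e)).
apply: (@limf_esup_pinfty_le _ _ r) => t; rewrite gt_max => /andP[t1 tC].
have t0 : 0 < t := lt_trans (expR_gt0 _) t1.
have t11 : 1 <= t by apply: le_trans (ltW t1); rewrite -expR0 ler_expR.
have lt0 : 0 < ln t.
  by rewrite ln_gt0 // (le_lt_trans _ t1) // -expR0 ler_expR.
rewrite lee_fin ler_pdivrMr //.
set m := max_modulus g t.
have tmu : 1 <= (t + 1) `^ mu.
  have e1 : 1 `^ mu = 1 :> R by rewrite powR1.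
  rewrite -[leLHS]e1; apply: ge0_ler_powR; rewrite ?nnegrE ?(ltW mu0) //.
    by rewrite addr_ge0 // ltW.
  by rewrite lerDr ltW.
have mle : m <= expR (C * t `^ mu).
  apply: max_modulus_le; first exact: ltW.
  move=> z zt; apply: le_trans (H z) _; rewrite zt ler_expR.
  apply: (@le_trans _ _ ((`|c| + k + 1) * (t + 1) `^ mu)).
    rewrite !mulrDl mul1r -addrA; apply: lerD.
      by apply: le_trans (ler_norm _) _; rewrite ler_peMr.
    by rewrite lerDl powR_ge0.
  rewrite -mulrA ler_wpM2l ?addr_ge0 //.
  rewrite -powRM ?(ltW t0) //; apply: ge0_ler_powR; rewrite ?nnegrE ?(ltW mu0) //.
  - by rewrite addr_ge0 // ltW.
  - by rewrite mulr_ge0 // ltW.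
  - by lra.
have muet : 0 <= (mu + e) * ln t by rewrite mulr_ge0 ?addr_ge0 // ltW.
have [h|h] := leP (ln m) 0; first by rewrite (ln0 h).
have m0 : 0 < m.
  by rewrite ltNge; apply/negP => /ln0 m0; rewrite m0 ltxx in h.
have lm : ln m <= C * t `^ mu.
  by rewrite -[leRHS]expRK; apply: ln_le.
apply: le_trans (ln_le h lm) _.
rewrite lnM ?posrE ?powR_gt0 // ln_powR mulrDl addrC lerD2l.
rewrite -ler_pdivrMl // mulrC -[leLHS]expRK.
by apply: ln_le; rewrite ?expR_gt0 // ltW.
Qed.

Lemma liouville M : (forall z, modulus (g z) <= M) -> forall z, g z = g 0.
Proof.
move=> H.
have g'0 z : g' z = 0.
  apply: modulus_le0; apply/ler_addgt0Pl => e e0; rewrite addr0.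
  have M0 : 0 <= M := le_trans (modulus_ge0 _) (H 0).
  have r0 : 0 < (M + 1) / e by rewrite divr_gt0 // ltr_wpDl.
  apply: le_trans (cauchy_estimate dg (M := M) r0 (fun z _ => H z)) _.
  by rewrite ler_pdivrMr // mulrC divfK ?gt_eqF // lerDl.
move=> z; apply/eqP; rewrite -subr_eq0; apply/eqP/modulus_le0.
rewrite -{1}[z]add0r -[leRHS](mul0r (modulus z)).
by apply: (mean_value (f' := g')) => // t _; rewrite g'0 modulus0.
Qed.

(** A negative upper limit would force [0 < ln M(r) < 1] for all large [r], hence
    [g] bounded, hence constant by Liouville's theorem; but for a constant [g]
    the quotient tends to 0.  So the real values of the order are those for
    which [theta_of_order] is the intended function. *)
Lemma order_ge0 : (0 <= order_entire g)%E.
Proof.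
rewrite leNgt; apply/negP => /limf_esup_pinfty_lt[r0 [y [y0 Hy]]].
have [eta eta0 Heta] : exists2 eta, 0 < eta & forall t : R, r0 < t ->
    ln (ln (max_modulus g t)) / ln t <= - eta.
  case: y y0 Hy => [y| |] // y0 Hy.
    exists (- y); first by rewrite oppr_gt0 -lte_fin.
    by move=> t /Hy; rewrite opprK lee_fin.
  by exists 1 => // t /Hy; rewrite leNgt ltNyr.
pose r := Num.max r0 (expR 1).
have r1 : expR 1 <= r by rewrite le_max lexx orbT.
have rr0 : r0 <= r by rewrite le_max lexx.
have rpos : 0 < r := lt_le_trans (expR_gt0 _) r1.
have lnr t : r < t -> 0 < ln t.
  by move=> rt; rewrite ln_gt0 // (le_lt_trans _ rt) // (le_trans _ r1) // -expR0 ler_expR.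
have small t : r < t -> max_modulus g t <= expR 1.
  move=> rt; have := Heta t (le_lt_trans rr0 rt).
  rewrite ler_pdivrMr ?lnr // => A.
  have {}A : ln (ln (max_modulus g t)) < 0.
    by apply: le_lt_trans A _; rewrite mulNr oppr_lt0 mulr_gt0 ?lnr.
  rewrite leNgt; apply/negP => h; move: A; rewrite ltNge; apply/negP/negPn.
  apply: ln_ge0; rewrite -[leLHS]expRK; apply: ln_le; [exact: expR_gt0|exact: ltW].
have [M HM] := bounded_on_disc dg (ltW rpos).
have cst : forall z, g z = g 0.
  apply: (@liouville (Num.max M (expR 1))) => z; rewrite le_max.
  have [zr|zr] := leP (modulus z) r; first by rewrite HM.
  by rewrite orbC (le_trans (le_max_modulus z)) // small.
have Mc t : 0 <= t -> max_modulus g t = modulus (g 0).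
  move=> t0; apply/eqP; rewrite eq_le max_modulus_le //=; last by move=> z _; rewrite cst.
  have := le_max_modulus t%:C; rewrite modulusC ger0_norm //.
  by rewrite cst.
pose q := ln (ln (modulus (g 0))).
pose t := Num.max (expR (`|q| / eta + 1)) (r + 1).
have rt : r < t by rewrite lt_max (ltrDl r) ltr01 orbT.
have t0 : 0 < t := lt_trans rpos rt.
have := Heta t (le_lt_trans rr0 rt).
rewrite Mc ?(ltW t0) // ler_pdivrMr ?lnr // -/q => A.
have lt1 : `|q| / eta + 1 <= ln t.
  by rewrite -[leLHS]expRK; apply: ln_le; rewrite ?expR_gt0 // le_max lexx.
have : `|q| < eta * ln t.
  apply: (@lt_le_trans _ _ (eta * (`|q| / eta + 1))); last by rewrite ler_wpM2l // ltW.
  by rewrite mulrDr mulrCA divff ?gt_eqF // mulr1 mulr1 ltrDl.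
by rewrite ltr_norml mulNr in A *; lra.
Qed.

Lemma theta_of_order_le s : s < 1 -> (order_entire g <= ((1 - s)^-1)%:E)%E ->
  theta_of_order (order_entire g) <= expR s.
Proof.
move=> s1; have := order_ge0; case: (order_entire g) => [x| |] //=.
  rewrite !lee_fin => x0 xs; case: eqP => [_|/eqP x1]; first exact: expR_ge0.
  have {x1}x0 : 0 < x by rewrite lt_def x1.
  have sg0 : 0 < 1 - s by rewrite subr_gt0.
  rewrite ler_expR; move: xs; rewrite -(lef_pV2) ?posrE ?invr_gt0 // invrK.
  lra.
Qed.

Lemma order_lt_of_theta s : s < 1 ->
  theta_of_order (order_entire g) < expR s -> (order_entire g < ((1 - s)^-1)%:E)%E.
Proof.
move=> s1; have sg0 : 0 < (1 - s)^-1 by rewrite invr_gt0 subr_gt0.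
case: (order_entire g) order_ge0 => [x| |] //=.
- rewrite !lee_fin lte_fin => x0; case: eqP => [->//|/eqP x1].
  have {x1}x0 : 0 < x by rewrite lt_def x1.
  rewrite ltr_expR => A; rewrite -ltf_pV2 ?posrE // invrK; lra.
- by move=> _; rewrite ltr_expR ltNge (ltW s1).
Qed.

Lemma theta_of_order_bounds :
  0 <= theta_of_order (order_entire g) <= expR 1.
Proof.
case: (order_entire g) order_ge0 => [x| |] //=; last by rewrite expR_ge0 lexx.
rewrite lee_fin => x0; case: eqP => _; first by rewrite lexx expR_ge0.
by rewrite expR_ge0 ler_expR gerBl invr_ge0.
Qed.

End Order.

(** * Upper limits of roots of derivatives *)

Section Theta.
Variable R : realType.
Implicit Types (z w : R[i]) (c k r s t tau e : R).

Lemma powR_root_leE (x E s : R) : 0 <= x -> 0 < E ->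
  (x `^ E^-1 <= expR s) = (x <= expR (s * E)).
Proof.
move=> x0 E0; have En0 : E != 0 by rewrite gt_eqF.
apply/idP/idP => H.
  rewrite expRM -[leLHS](powRr1 x0) -(mulVf En0) powRrM.
  by apply: ge0_ler_powR; rewrite ?nnegrE ?powR_ge0 ?expR_ge0 ?(ltW E0).
rewrite -[s](mulfK En0) expRM.
by apply: ge0_ler_powR; rewrite ?nnegrE ?expR_ge0 ?invr_ge0 ?(ltW E0).
Qed.

(** The normalisation of [theta_even] and [theta_odd], for the index [2 j]. *)
Definition nlogn2 (j : nat) : R := j.*2%:R * ln j%:R.

(** The two scales differ by a linear term, which the factors [K ^ n] absorb. *)
Lemma nlogn_near_nlogn2 b j : (b <= 2)%N -> (0 < j)%N ->
  `|nlogn R (j.*2 + b) - nlogn2 j| <= 12 * j%:R.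
Proof.
move=> b2 j0; have j1 : 1 <= j%:R :> R by rewrite ler1n.
have jp : 0 < j%:R :> R by rewrite ltr0n.
have d2 : j.*2%:R = 2 * j%:R :> R by rewrite -mul2n natrM.
have nE : (j.*2 + b)%:R = 2 * j%:R + b%:R :> R by rewrite natrD d2.
have b0 : 0 <= b%:R :> R by rewrite ler0n.
have b1 : b%:R <= 2 :> R by rewrite ler_nat.
rewrite /nlogn /nlogn2 nE d2.
have lj : 0 <= ln j%:R :> R by rewrite ln_ge0.
have -> : ln (2 * j%:R + b%:R) = ln j%:R + ln (2 + b%:R / j%:R) :> R.
  rewrite -lnM ?posrE // ?ltr_wpDr ?divr_ge0 ?(ltW jp) //.
  by rewrite mulrDr mulrCA divff ?gt_eqF // mulr1 mulrC.
set q := ln (2 + _).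
have bj : 0 <= b%:R / j%:R :> R by rewrite divr_ge0 // ltW.
have bj1 : b%:R / j%:R <= 2 :> R by rewrite ler_pdivrMr //; lra.
have q0 : 0 <= q by rewrite ln_ge0 //; lra.
have q3 : q <= 3.
  by apply: le_trans (ln_le_sub1 _) _; lra.
have lj1 : ln j%:R <= j%:R - 1 :> R by apply: ln_le_sub1.
have -> : (2 * j%:R + b%:R) * (ln j%:R + q) - 2 * j%:R * ln j%:R =
   2 * (j%:R * q) + b%:R * ln j%:R + b%:R * q by ring.
have jq0 : 0 <= j%:R * q by rewrite mulr_ge0 // ltW.
have jq : j%:R * q <= j%:R * 3 by rewrite ler_wpM2l ?(ltW jp) //; lra.
have bl0 : 0 <= b%:R * ln j%:R :> R by rewrite mulr_ge0.
have bl : b%:R * ln j%:R <= 2 * (j%:R - 1) :> R by rewrite ler_pM.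
have bq0 : 0 <= b%:R * q by rewrite mulr_ge0.
have bq : b%:R * q <= 2 * 3 by rewrite ler_pM //; lra.
rewrite ger0_norm ?addr_ge0 ?mulr_ge0 //.
lra.
Qed.

Lemma ln_nat_large (x : R) : exists N, forall n, (N <= n)%N ->
  (0 < n)%N /\ x <= ln n%:R.
Proof.
exists (Num.truncn (expR x)).+1 => n Nn; split; first by apply: leq_trans Nn.
rewrite -[x]expRK; apply: ln_le; rewrite ?expR_gt0 //.
by apply: le_trans (ltW (truncnS_gt _)) _; rewrite ler_nat.
Qed.

Lemma nlogn_dominates c k s t : s < t -> exists N, forall n, (N <= n)%N ->
  0 < nlogn R n /\ c + k * n%:R + s * nlogn R n <= t * nlogn R n.
Proof.
move=> st; have ts : 0 < t - s by rewrite subr_gt0.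
have [N HN] := ln_nat_large (Num.max 1 ((`|c| + `|k|) / (t - s))).
exists N => n /HN[n0]; rewrite ge_max => /andP[l1 lck].
have n1 : 1 <= n%:R :> R by rewrite ler1n.
have np : 0 < n%:R :> R by rewrite ltr0n.
split; first by rewrite mulr_gt0 //; lra.
rewrite -lerBrDr -mulrBl /nlogn.
apply: (@le_trans _ _ ((`|c| + `|k|) * n%:R)).
  rewrite mulrDl lerD //.
    by apply: le_trans (ler_norm _) _; rewrite ler_peMr.
  by rewrite ler_wpM2r ?(ltW np) // ler_norm.
by rewrite mulrCA mulrC ler_wpM2l ?(ltW np) // mulrC -ler_pdivrMr.
Qed.

Lemma nlogn2_dominates k s t : s < t -> exists N, forall j, (N <= j)%N ->
  [/\ (0 < j)%N, 0 < nlogn2 j & k * j%:R + s * nlogn2 j <= t * nlogn2 j].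
Proof.
move=> st; have ts : 0 < t - s by rewrite subr_gt0.
have [N HN] := ln_nat_large (Num.max 1 (`|k| / (t - s))).
exists N => n /HN[n0]; rewrite ge_max => /andP[l1 lck].
have n1 : 1 <= n%:R :> R by rewrite ler1n.
have np : 0 < n%:R :> R by rewrite ltr0n.
have d2 : n.*2%:R = 2 * n%:R :> R by rewrite -mul2n natrM.
split => //; first by rewrite /nlogn2 d2 mulr_gt0 ?mulr_gt0 //; lra.
rewrite -lerBrDr -mulrBl /nlogn2 d2.
apply: (@le_trans _ _ (`|k| * n%:R)).
  by rewrite ler_wpM2r ?(ltW np) // ler_norm.
move: lck; rewrite ler_pdivrMr // => lck.
have h : `|k| * n%:R <= ln n%:R * (t - s) * n%:R by rewrite ler_wpM2r ?(ltW np).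
have h2 : 0 <= ln n%:R * (t - s) * n%:R by rewrite !mulr_ge0 ?(ltW np) ?(ltW ts) //; lra.
lra.
Qed.

Lemma nlogn_le_nlogn2 b c k s : (b <= 2)%N -> exists k', forall j, (0 < j)%N ->
  c + k * (j.*2 + b)%:R + s * nlogn R (j.*2 + b) <= k' * j%:R + s * nlogn2 j.
Proof.
move=> b2; exists (`|c| + 4 * `|k| + 12 * `|s|) => j j0.
have j1 : 1 <= j%:R :> R by rewrite ler1n.
have := nlogn_near_nlogn2 b2 j0; set X := nlogn R _; set Y := nlogn2 j => XY.
have sXY : s * (X - Y) <= `|s| * (12 * j%:R).
  by apply: le_trans (ler_norm _) _; rewrite normrM ler_wpM2l.
have kb : k * (j.*2 + b)%:R <= `|k| * (4 * j%:R).
  apply: (@le_trans _ _ (`|k| * (j.*2 + b)%:R)).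
    by rewrite ler_wpM2r // ler_norm.
  rewrite ler_wpM2l // natrD -mul2n natrM.
  have : b%:R <= 2 :> R by rewrite ler_nat.
  lra.
have cj : c <= `|c| * j%:R by apply: le_trans (ler_norm _) _; rewrite ler_peMr.
lra.
Qed.

Lemma nlogn2_le_nlogn b k s : (b <= 2)%N -> exists k', forall j, (0 < j)%N ->
  k * j%:R + s * nlogn2 j <= k' * (j.*2 + b)%:R + s * nlogn R (j.*2 + b).
Proof.
move=> b2; exists (`|k| + 12 * `|s|) => j j0.
have := nlogn_near_nlogn2 b2 j0; set X := nlogn R _; set Y := nlogn2 j => XY.
have sXY : - s * (X - Y) <= `|s| * (12 * j%:R).
  by apply: le_trans (ler_norm _) _; rewrite normrM normrN ler_wpM2l.
have jb : j%:R <= (j.*2 + b)%:R :> R.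
  by rewrite ler_nat -addnn -addnA leq_addr.
have kb : k * j%:R <= `|k| * (j.*2 + b)%:R.
  apply: (@le_trans _ _ (`|k| * j%:R)); last by rewrite ler_wpM2l.
  by rewrite ler_wpM2r // ler_norm.
have sb : `|s| * j%:R <= `|s| * (j.*2 + b)%:R by rewrite ler_wpM2l.
lra.
Qed.

(** Comparison with positive reals written as exponentials suffices, since all
    the quantities are nonnegative. *)
Lemma ereal_squeeze (l : \bar R) (theta : R) : (0 <= l)%E -> (l <= theta%:E)%E ->
  (forall s, expR s < theta -> (l < (expR s)%:E)%E -> False) -> l = theta%:E.
Proof.
case: l => [x| |] //; rewrite !lee_fin => x0 xt H.
congr (_%:E); apply/eqP; rewrite eq_le xt /= leNgt; apply/negP => xlt.
have m0 : 0 < (x + theta) / 2 by lra.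
by apply: (H (ln ((x + theta) / 2))); rewrite lnK ?posrE // ?lte_fin; lra.
Qed.

Lemma limn_esup_powR_ge0 (x E : nat -> R) :
  (0 <= limn_esup (fun n => (x n `^ E n)%:E))%E.
Proof.
rewrite /limn_esup; apply: limf_esup_ge0.
  by move=> [N _ /(_ N)] /=; rewrite leqnn => /(_ isT).
by move=> n; rewrite lee_fin powR_ge0.
Qed.

Variable g : R[i] -> R[i].
Hypothesis eg : entire g.
Let theta := theta_of_order (order_entire g).
Let D n := cderiv n g.
Let dD : forall n z, cdiff (D n) z (D n.+1 z) := cdiff_cderiv eg.

Lemma log_bounded_of_theta s : theta < expR s -> locally_log_bounded D s.
Proof.
move=> ths; have [s1|s1] := leP 1 s.
  exact: locally_log_bounded_le s1 (locally_log_bounded1 dD).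
have s0 : 0 < (1 - s)^-1 by rewrite invr_gt0 subr_gt0.
have [c Hc] := growth_of_order (dD 0) s0 (order_lt_of_theta (dD 0) s1 ths).
have := log_bounded_of_growth dD s0 Hc.
by rewrite invrK (_ : 1 - (1 - s) = s) //; ring.
Qed.

(** The finitely many derivatives of order less than [N] are absorbed in the
    constant; the shift from [z0] to 0 only changes the constants in the growth. *)
Lemma theta_le_of_log_bounded N z0 c k s :
  (forall n, (N <= n)%N -> modulus (D n z0) <= expR (c + k * n%:R + s * nlogn R n)) ->
  theta <= expR s.
Proof.
move=> H; have /andP[th0 th1] := theta_of_order_bounds (dD 0).
have [s1|s1] := leP 1 s; first by apply: (le_trans th1); rewrite ler_expR.
pose C := `|c| + \sum_(n < N) (modulus (D n z0) + `|k| * n%:R + `|s| * nlogn R n).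
have t0 n : 0 <= modulus (D n z0) + `|k| * n%:R + `|s| * nlogn R n.
  apply: addr_ge0; last by rewrite mulr_ge0 ?nlogn_ge0.
  by apply: addr_ge0; rewrite ?modulus_ge0 ?mulr_ge0.
have {}H n : modulus (D n z0) <= expR (C + k * n%:R + s * nlogn R n).
  have [/H A|nN] := leqP N n.
    apply: (le_trans A); rewrite ler_expR !lerD2r /C.
    by apply: ler_wpDr (ler_norm _); rewrite sumr_ge0.
  apply: (@le_trans _ _ (expR (modulus (D n z0)))).
    by apply: le_trans (expR_ge1Dx _); rewrite lerDr.
  rewrite ler_expR.
  have : modulus (D n z0) + `|k| * n%:R + `|s| * nlogn R n <= C.
    rewrite /C (bigD1 (Ordinal nN)) //= addrCA lerDl addr_ge0 //.
    by rewrite sumr_ge0.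
  have A : - k * n%:R <= `|k| * n%:R by rewrite ler_wpM2r // -normrN ler_norm.
  have B : - s * nlogn R n <= `|s| * nlogn R n.
    by rewrite ler_wpM2r ?nlogn_ge0 // -normrN ler_norm.
  lra.
have [c' [k' [k'0 Hg]]] := growth_of_log_bounded dD s1 H.
apply: (theta_of_order_le (dD 0)) => //.
have mu0 : 0 < (1 - s)^-1 by rewrite invr_gt0 subr_gt0.
pose Z := modulus z0 + 1.
have Z1 : 1 <= Z by rewrite lerDr modulus_ge0.
apply: (order_le_of_growth (g := g) (c := c') (k := k' * Z `^ (1 - s)^-1) mu0).
  by rewrite mulr_ge0 ?powR_ge0.
move=> z; have := Hg (z - z0); rewrite subrKC => A; apply: le_trans A _.
rewrite ler_expR lerD2l -mulrA ler_wpM2l // -powRM ?addr_ge0 ?modulus_ge0 //.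
apply: ge0_ler_powR; rewrite ?nnegrE ?mulr_ge0 ?addr_ge0 ?modulus_ge0 ?(ltW mu0) //.
have zz := modulus_subD z z0.
have : 0 <= modulus z0 * modulus z by rewrite mulr_ge0 ?modulus_ge0.
rewrite /Z; lra.
Qed.

(** Stated for a general subsequence [p] of derivatives and a general
    normalisation [E], to serve for all three upper limits. *)
Lemma theta_upper (E : nat -> R) (p : nat -> nat) z :
  (forall c k s t, s < t -> exists N, forall n, (N <= n)%N ->
     0 < E n /\ c + k * (p n)%:R + s * nlogn R (p n) <= t * E n) ->
  (limn_esup (fun n => (modulus (D (p n) z) `^ (E n)^-1)%:E) <= theta%:E)%E.
Proof.
move=> HE; have /andP[th0 _] := theta_of_order_bounds (dD 0).
apply/lee_addgt0Pr => e e0; rewrite -EFinD.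
have m0 : 0 < theta + e / 2 by rewrite ltr_wpDl // divr_gt0.
have m1 : 0 < theta + e by rewrite ltr_wpDl.
have [c [k Hck]] : exists c k, forall n w, modulus w <= modulus z ->
    modulus (D n w) <= expR (c + k * n%:R + ln (theta + e / 2) * nlogn R n).
  apply: log_bounded_of_theta; last exact: modulus_ge0.
  by rewrite lnK ?posrE // ltrDl divr_gt0.
have st : ln (theta + e / 2) < ln (theta + e) by rewrite ltr_ln ?posrE //; lra.
have [N HN] := HE c k _ _ st.
apply: (@limn_esup_le _ _ _ N) => n /HN[E0 A]; rewrite lee_fin.
rewrite -[leRHS](lnK (x := theta + e)) ?posrE // powR_root_leE ?modulus_ge0 //.
by apply: le_trans (Hck _ _ (lexx _)) _; rewrite ler_expR.
Qed.

Lemma theta_allE z : theta_all g z = theta%:E.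
Proof.
apply: ereal_squeeze.
- exact: limn_esup_powR_ge0.
- apply: (@theta_upper (@nlogn R) id) => c k s t st.
  exact: nlogn_dominates.
- move=> s sth /limn_esup_lt[N HN]; have [N' HN'] := @nlogn_dominates 0 0 s (s + 1) ltac:(lra).
  move: sth; rewrite ltNge => /negP; apply.
  apply: (@theta_le_of_log_bounded (maxn N N') z 0 0) => n; rewrite geq_max => /andP[/HN A /HN'[E0 _]].
  rewrite mul0r !add0r -powR_root_leE ?modulus_ge0 //.
  by move: A; rewrite lte_fin => /ltW.
Qed.

Lemma theta_pair_le b z : (b <= 1)%N ->
  (limn_esup (fun j => (modulus (D (j.*2 + b) z) `^ (nlogn2 j)^-1)%:E) <= theta%:E)%E.
Proof.
move=> b1; apply: (@theta_upper nlogn2 (fun j => j.*2 + b)%N) => c k s t st.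
have [k' Hk'] := nlogn_le_nlogn2 c k s (leqW b1).
have [N HN] := nlogn2_dominates k' st.
by exists N => j /HN[j0 E0 A]; split => //; apply: le_trans (Hk' j j0) _.
Qed.

End Theta.

(** * Interpolation at well separated points *)

Section Interpolation.
Variable R : realType.
Implicit Types (w : R[i]) (r c B delta : R) (E : set R).
Local Notation mu := (@lebesgue_measure R).

(** Greedy choice: pick a point of [E] close to its infimum and discard all points
    less than [delta] to its right.  This removes a set of length at most
    [2 * delta].  Beyond the index [N] only the separation matters. *)
Lemma separated_points E N delta r : measurable E -> 0 < delta ->
  (forall t, E t -> - r <= t) -> ((2 * N%:R * delta)%:E < mu E)%E ->
  exists t : nat -> R, (forall i, (i <= N)%N -> E (t i)) /\
    forall i j, (i < j)%N -> (j - i)%:R * delta <= t j - t i.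
Proof.
move=> mE d0; elim: N E mE => [|N IH] E mE Er muE.
  have [t0 Et0] : E !=set0.
    apply/set0P/eqP => E0; move: muE; rewrite E0 measure0 mulr0 mul0r ltxx //.
  exists (fun i => t0 + i%:R * delta); split.
    by move=> i; rewrite leqn0 => /eqP->; rewrite mul0r addr0.
  move=> i j ij; rewrite natrB ?(ltnW ij) // le_eqVlt; apply/orP; left.
  by apply/eqP; ring.
have E0 : E !=set0.
  apply/set0P/eqP => E0; move: muE; rewrite E0 measure0 ltNge lee_fin.
  by rewrite !mulr_ge0 ?ler0n // ltW.
have Einf : has_inf E by split => //; exists (- r).
have [t0 Et0 t0m] := inf_adherent d0 Einf.
set m := inf E in t0m.
pose E' := E `&` `[t0 + delta, +oo[.
have mE' : measurable E' by apply: measurableI.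
pose I : set R := `[m, m + 2 * delta]%classic.
have mI : measurable I by exact: measurable_itv.
have Esub : E `<=` E' `|` I.
  move=> t Et; have [tt|tt] := leP (t0 + delta) t.
    by left; split => //=; rewrite in_itv /= andbT.
  right; rewrite /I /= in_itv /=; apply/andP; split.
    by apply: ge_inf => //; case: Einf.
  by move: t0m; lra.
have muE' : ((2 * N%:R * delta)%:E < mu E')%E.
  have : (mu E <= mu E' + (2 * delta)%:E)%E.
    apply: (@le_trans _ _ (mu (E' `|` I))).
      by apply: le_measure => //; rewrite ?inE //; exact: measurableU.
    apply: (@le_trans _ _ (mu E' + mu I)%E); first exact: measureU2.
    rewrite leeD2l // lebesgue_measure_itv /= lte_fin ltrDl mulr_gt0 //.
    by rewrite -EFinD addrAC subrr add0r.
  move=> H; have {H} := lt_le_trans muE H.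
  case: (mu E') => [x| |] //=.
    rewrite -EFinD !lte_fin -natr1 => h; lra.
  by move=> _; rewrite ltry.
have [t [tE tsep]] := IH E' mE' (fun t h => Er t h.1) muE'.
exists (fun i => if i is i'.+1 then t i' else t0); split.
  by case=> [|i] //; rewrite ltnS => /tE[].
move=> [|i] [|j] //; rewrite ?ltnS => ij; last by rewrite subSS; exact: tsep.
have := (tE 0%N isT).2; rewrite /= in_itv /= andbT => h0.
rewrite subn0 -natr1.
case: j ij => [|j] _; first by lra.
by have := tsep 0%N j.+1 isT; rewrite subn0; lra.
Qed.

Lemma prod_rsub_fact n : (\prod_(0 <= j < n) (n - j) = n`!)%N.
Proof.
elim: n => [|n IH]; first by rewrite big_nil.
by rewrite big_nat_recl //= subn0 factS -IH.
Qed.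

Lemma prod_lsub_fact n m : (\prod_(n.+1 <= j < n.+1 + m) (j - n) = m`!)%N.
Proof.
elim: m => [|m IH]; first by rewrite addn0 big_geq.
rewrite addnS big_nat_recr ?leq_addr //= IH factS mulnC.
by rewrite addSn -addnS addnC addnK.
Qed.

Lemma prod_dist_fact N (i : 'I_N.+1) :
  (\prod_(j < N.+1 | j != i) ((i - j) + (j - i)) = i`! * (N - i)`!)%N.
Proof.
have iN : (i <= N)%N by rewrite -ltnS.
rewrite (eq_bigl (fun j : 'I_N.+1 => val j != val i)) //.
rewrite -(big_mkord (fun j => j != val i) (fun j => (i - j) + (j - i))%N).
rewrite (@big_cat_nat _ _ _ i) //=; last exact: leqW.
congr (_ * _)%N.
  rewrite -prod_rsub_fact big_nat_cond [RHS]big_nat_cond.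
  apply: eq_big => j; first by case: ltngtP; rewrite ?andbF.
  by move=> /andP[/andP[_ ji] _]; rewrite (_ : (j - i) = 0)%N ?addn0 //; apply/eqP; rewrite subn_eq0 ltnW.
rewrite big_ltn_cond // eqxx /= -(prod_lsub_fact i).
rewrite addSn subnKC // big_nat_cond [RHS]big_nat_cond.
apply: eq_big => j; first by case: ltngtP; rewrite ?andbF.
by move=> /andP[/andP[ij _] _]; rewrite (_ : (i - j) = 0)%N ?add0n //; apply/eqP; rewrite subn_eq0 ltnW.
Qed.

Lemma bin_le_exp2 n m : ('C(n, m) <= 2 ^ n)%N.
Proof.
have [nm|mn] := ltnP n m; first by rewrite bin_small.
rewrite (_ : 2 = 1 + 1)%N // expnDn.
rewrite (bigD1 (Ordinal (mn : (m < n.+1)%N))) //= !exp1n !muln1.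
exact: leq_addr.
Qed.

(** In Lagrange's formula the denominator of the [i]-th term is at least
    [delta ^ N * (i! * (N - i)!)], and [N! <= 2 ^ N * (i! * (N - i)!)]. *)
Lemma lagrange_bound (x : nat -> R[i]) N (p : {poly R[i]}) B r delta w :
  (size p <= N.+1)%N -> 0 < delta -> 0 <= r ->
  (forall i j, (i < j)%N -> (j - i)%:R * delta <= modulus (x j - x i)) ->
  (forall i, (i <= N)%N -> modulus (x i) <= r) ->
  (forall i, (i <= N)%N -> modulus p.[x i] <= B) -> modulus w <= r ->
  modulus p.[w] <= B * (8 * r / delta) ^+ N / N`!%:R.
Proof.
move=> sp d0 r0 xsep xr pB wr.
have B0 : 0 <= B := le_trans (modulus_ge0 _) (pB 0%N isT).
have sep i j : i != j -> ((i - j) + (j - i))%:R * delta <= modulus (x i - x j).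
  case: (ltngtP i j) => // ij _.
    rewrite (_ : (i - j) = 0)%N ?add0n; last by apply/eqP; rewrite subn_eq0 ltnW.
    by rewrite modulusB xsep.
  rewrite (_ : (j - i) = 0)%N ?addn0; last by apply/eqP; rewrite subn_eq0 ltnW.
  exact: xsep.
have x_inj : injective x.
  move=> i j xij; apply/eqP/negPn/negP => /[dup] ij /sep.
  rewrite xij subrr modulus0 leNgt; apply/negP/negPn; rewrite mulr_gt0 // ltr0n.
  by move: ij; case: (ltngtP i j) => // ij _; rewrite addn_gt0 !subn_gt0 ij ?orbT.
rewrite (lagrange_gen (ltn0Sn N) x_inj sp) horner_sum.
apply: le_trans (modulus_sum _ _ _) _.
have fN : 0 < (N`!)%:R :> R by rewrite ltr0n fact_gt0.
have term (i : 'I_N.+1) : modulus ((p.[x i])%:P * tnth (lagrange N.+1 x) i).[w] <=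
    B * (4 * r / delta) ^+ N / N`!%:R.
  rewrite hornerM hornerC modulusM -!mulrA ler_pM ?modulus_ge0 ?pB // -1?ltnS //.
  rewrite (lagrangeE (ltn0Sn N) x_inj) /= hornerM hornerC modulusM modulusV.
  rewrite !horner_prod !modulus_prod.
  have num : \prod_(j < N.+1 | j != i) modulus ('X - (x j)%:P).[w] <= (2 * r) ^+ N.
    apply: (@le_trans _ _ (\prod_(j < N.+1 | j != i) (2 * r))).
      apply: ler_prod => j _; rewrite modulus_ge0 /= hornerXsubC.
      apply: le_trans (modulus_subD _ _) _.
      have xj : modulus (x j) <= r by apply: xr; rewrite -ltnS.
      by rewrite mulrDl mul1r lerD.
    by rewrite prodr_const cardC1 card_ord.
  have den : delta ^+ N * (i`! * (N - i)`!)%:R <=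
      \prod_(j < N.+1 | j != i) modulus ('X - (x j)%:P).[x i].
    rewrite -prod_dist_fact natr_prod.
    have -> : delta ^+ N = \prod_(j < N.+1 | j != i) delta.
      by rewrite prodr_const cardC1 card_ord.
    rewrite -big_split /=; apply: ler_prod => j ji.
    rewrite mulr_ge0 ?(ltW d0) //= hornerXsubC mulrC sep //.
    by rewrite eq_sym.
  have fi : 0 < (i`! * (N - i)`!)%:R :> R by rewrite ltr0n muln_gt0 !fact_gt0.
  have dn : 0 < delta ^+ N * (i`! * (N - i)`!)%:R by rewrite mulr_gt0 ?exprn_gt0.
  apply: (@le_trans _ _ ((delta ^+ N * (i`! * (N - i)`!)%:R)^-1 * (2 * r) ^+ N)).
    apply: ler_pM => //.
    - by rewrite invr_ge0; apply: prodr_ge0 => j _; exact: modulus_ge0.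
    - by apply: prodr_ge0 => j _; exact: modulus_ge0.
    - by rewrite lef_pV2 ?posrE // (lt_le_trans dn).
  have binE : (N`!)%:R <= 2 ^+ N * (i`! * (N - i)`!)%:R :> R.
    rewrite -natrX -natrM ler_nat -(@bin_fact N i); last by rewrite -ltnS.
    by rewrite leq_mul2r bin_le_exp2 orbT.
  have finv : ((i`! * (N - i)`!)%:R)^-1 <= 2 ^+ N / N`!%:R :> R.
    by rewrite ler_pdivlMr // mulrC ler_pdivrMr.
  rewrite invfM -exprVn mulrAC -exprMn.
  have -> : 4 * (r / delta) = delta^-1 * (2 * r) * 2 by ring.
  rewrite [in leRHS]exprMn -mulrA ler_wpM2l // exprn_ge0 //.
  by rewrite !mulr_ge0 // invr_ge0 ltW.
apply: le_trans (ler_sum _ (fun i _ => term i)) _.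
rewrite sumr_const card_ord -[leLHS]mulr_natl.
have -> : 8 * r / delta = 2 * (4 * r / delta) by ring.
set X := 4 * r / delta.
have X0 : 0 <= X by rewrite !mulr_ge0 // invr_ge0 ltW.
clearbody X.
have h : N.+1%:R * X ^+ N <= (2 * X) ^+ N.
  by rewrite exprMn ler_wpM2r ?exprn_ge0 // -natrX ler_nat ltn_expl.
have -> : N.+1%:R * (B * X ^+ N / N`!%:R) = B / N`!%:R * (N.+1%:R * X ^+ N) by ring.
by rewrite [leRHS]mulrAC ler_wpM2l // divr_ge0.
Qed.

(** The separation [c / N] makes [lagrange_bound] exponential in [N], because
    [N ^ N / N! <= e ^ N]. *)
Lemma remez E (p : {poly R[i]}) N B r c w : measurable E -> 0 < c -> 0 <= r ->
  ((2 * c)%:E < mu E)%E -> (forall t, E t -> `|t| <= r) -> (0 < N)%N ->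
  (size p <= N.+1)%N -> (forall t : R, E t -> modulus p.[t%:C * 'i] <= B) ->
  modulus w <= r -> modulus p.[w] <= B * (8 * expR 1 * r / c) ^+ N.
Proof.
move=> mE c0 r0 muE Er N0 sp pB wr.
have Np : 0 < N%:R :> R by rewrite ltr0n.
have d0 : 0 < c / N%:R by rewrite divr_gt0.
have [t [tE tsep]] := @separated_points E N (c / N%:R) r mE d0
  ltac:(by move=> t /Er; rewrite ler_norml => /andP[])
  ltac:(by rewrite mulrAC -mulrA divfK ?gt_eqF).
have B0 : 0 <= B := le_trans (modulus_ge0 _) (pB _ (tE 0%N isT)).
apply: le_trans (@lagrange_bound (fun i => (t i)%:C * 'i) N p B r (c / N%:R) w sp d0 r0 _ _ _ wr) _.
- move=> i j ij; rewrite -mulrBl modulusM modulus_i mulr1 -rmorphB modulusC.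
  by apply: le_trans (tsep i j ij) _; exact: ler_norm.
- by move=> i iN; rewrite modulusM modulus_i mulr1 modulusC; exact: Er (tE i iN).
- by move=> i iN; exact: pB (tE i iN).
rewrite -mulrA ler_wpM2l //.
have fN : 0 < (N`!)%:R :> R by rewrite ltr0n fact_gt0.
rewrite ler_pdivrMr //.
have -> : 8 * r / (c / N%:R) = (8 * r / c) * N%:R by field; rewrite !gt_eqF.
have -> : 8 * expR 1 * r / c = (8 * r / c) * expR 1 by ring.
set X := 8 * r / c.
have X0 : 0 <= X by rewrite !mulr_ge0 // invr_ge0 ltW.
clearbody X.
rewrite exprMn [in leRHS]exprMn -mulrA ler_wpM2l ?exprn_ge0 //.
by rewrite -expRM_natl mulr1 mulrC expn_le_fact_exp.
Qed.

End Interpolation.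

(** * Exceptional sets on vertical lines *)

Section Slices.
Variable R : realType.
Implicit Types (z w : R[i]) (c k r s t tau e : R).
Local Notation mu := (@lebesgue_measure R).
Variable g : R[i] -> R[i].
Hypothesis eg : entire g.
Let theta := theta_of_order (order_entire g).
Let D n := cderiv n g.
Let dD : forall n z, cdiff (D n) z (D n.+1 z) := cdiff_cderiv eg.

(** The larger radius [rho] is such that the Taylor remainder gains a factor
    [(2 * K) ^ (- N)] on the disc, which beats the factor [K ^ N] lost when
    passing from [E] to the disc by [remez]. *)
Lemma two_constants m (E : set R) x c r rho A B N w : measurable E -> 0 < c -> c <= r ->
  ((2 * c)%:E < mu E)%E -> (forall t, E t -> `|t| <= r) -> (0 < N)%N ->
  let K := 8 * expR 1 * r / c in rho = 2 * K * expR 1 * r ->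
  (forall z, modulus (z - x) <= r + rho -> modulus (D m z) <= A) ->
  (forall t : R, E t -> modulus (D m (x + t%:C * 'i)) <= B) ->
  modulus w <= r ->
  modulus (D m (x + w)) <= K ^+ N * B + 2 * A * 2^-1 ^+ N.
Proof.
move=> mE c0 cr muE Er N0 K rhoE DA DB wr.
have r0 : 0 < r := lt_le_trans c0 cr.
have e1 : 1 <= expR 1 :> R by rewrite -[leLHS]expR0 ler_expR.
have K1 : 1 <= K.
  rewrite /K ler_pdivlMr // mul1r; apply: (le_trans cr).
  by rewrite ler_peMl ?(ltW r0) //; lra.
have rho0 : 0 < rho.
  rewrite rhoE; apply: mulr_gt0 => //; apply: mulr_gt0; rewrite ?expR_gt0 //; lra.
have A0 : 0 <= A.
  apply: le_trans (modulus_ge0 _) (DA x _).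
  by rewrite subrr modulus0 addr_ge0 ?ltW.
have ratio : expR 1 * r / rho = (2 * K)^-1.
  rewrite rhoE; field; rewrite !gt_eqF ?expR_gt0 //; lra.
pose q := (2 * K)^-1; have q0 : 0 <= q by rewrite invr_ge0; lra.
have q1 : q <= 1 by rewrite invf_le1; lra.
have q2 : q <= 2^-1 by rewrite /q lef_pV2 ?posrE //; lra.
have qK : q * K = 2^-1 by rewrite /q; field; rewrite gt_eqF //; lra.
have rem u : modulus u <= r ->
    modulus (D m (x + u) - taylor D m N.+1 x u) <= A * q ^+ N.
  move=> ur; apply: le_trans (taylor_remainder_geometric dD N.+1 rho0 ur DA) _.
  rewrite ratio -/q ler_wpM2l // exprS ler_piMl // exprn_ge0 //.
pose p := \poly_(j < N.+1) (D (m + j) x / j`!%:R).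
have pE u : p.[u] = taylor D m N.+1 x u by rewrite horner_poly.
have onE t : E t -> modulus p.[t%:C * 'i] <= B + A * q ^+ N.
  move=> Et; have ut : modulus (t%:C * 'i) <= r.
    by rewrite modulusM modulus_i mulr1 modulusC Er.
  rewrite pE -[taylor _ _ _ _ _](subrKC (D m (x + t%:C * 'i))).
  apply: le_trans (modulusD _ _) _; apply: lerD; first exact: DB.
  by rewrite modulusB rem.
have onDisc : modulus (taylor D m N.+1 x w) <= (B + A * q ^+ N) * K ^+ N.
  by rewrite -pE; apply: (remez mE c0 (ltW r0) muE Er N0 (size_poly _ _) onE wr).
rewrite -(subrK (taylor D m N.+1 x w) (D m _)).
apply: le_trans (modulusD _ _) _.
apply: le_trans (lerD (rem w wr) onDisc) _.
clearbody q K.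
have qh : q ^+ N <= 2^-1 ^+ N by rewrite lerXn2r ?nnegrE.
have Kq : q ^+ N * K ^+ N = 2^-1 ^+ N by rewrite -exprMn qK.
have -> : (B + A * q ^+ N) * K ^+ N = K ^+ N * B + A * (q ^+ N * K ^+ N) by ring.
rewrite Kq -[2 * A * _]mulrA mulr_natl mulr2n addrCA lerD2l lerD2r.
by rewrite ler_wpM2l.
Qed.

(** If the slice had positive length, [two_constants] with [N] about
    [eta * 2j ln j] would replace the pair of bounds [exp (s * 2j ln j)] on the
    slice and [exp (sg * 2j ln j)] on discs, where [sg] is slightly larger than
    [ln theta], by [exp (s' * 2j ln j)] on a disc with [s' < ln theta]. *)
Lemma slice_null b (s : R) J x r : (b <= 1)%N -> expR s < theta -> 1 <= r ->
  measurable [set y | `|y| <= r /\ forall j, (J <= j)%N ->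
    modulus (D (j.*2 + b) (x +i* y)) <= expR (s * nlogn2 R j)] ->
  mu [set y | `|y| <= r /\ forall j, (J <= j)%N ->
    modulus (D (j.*2 + b) (x +i* y)) <= expR (s * nlogn2 R j)] = 0.
Proof.
move=> b1 sth r1; set E := [set y | _] => mE.
apply/eqP; rewrite eq_le measure_ge0 andbT leNgt; apply/negP => muE0.
have [c [c0 [cr muE]]] : exists c, 0 < c /\ c <= r /\ ((2 * c)%:E < mu E)%E.
  case: (mu E) muE0 => [a| |] // a0.
    rewrite lte_fin in a0; exists (Num.min r (a / 3)).
    split; first by rewrite lt_min divr_gt0 // (lt_le_trans _ r1).
    split; first by rewrite ge_min lexx.
    have : Num.min r (a / 3) <= a / 3 by rewrite ge_min lexx orbT.
    by rewrite lte_fin; lra.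
  by exists r; rewrite lexx ltry (lt_le_trans _ r1).
have r0 : 0 < r by apply: lt_le_trans r1.
pose K := 8 * expR 1 * r / c.
have e1 : 1 <= expR 1 :> R by rewrite -[leLHS]expR0 ler_expR.
have K1 : 1 <= K.
  rewrite /K ler_pdivlMr // mul1r; apply: (le_trans cr).
  by rewrite ler_peMl ?(ltW r0) //; lra.
pose rho := 2 * K * expR 1 * r.
have rho0 : 0 < rho.
  apply: mulr_gt0 => //; apply: mulr_gt0; rewrite ?expR_gt0 //; lra.
have twoc j w A N : (0 < N)%N -> (J <= j)%N -> modulus w <= r ->
    (forall z, modulus (z - x%:C) <= r + rho -> modulus (D (j.*2 + b) z) <= A) ->
    modulus (D (j.*2 + b) (x%:C + w)) <=
      K ^+ N * expR (s * nlogn2 R j) + 2 * A * 2^-1 ^+ N.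
  move=> N0 Jj wr DA; apply: (two_constants mE c0 cr muE _ N0 erefl DA _ wr).
    by move=> t [].
  move=> t [_ /(_ j Jj)]; congr (modulus (D _ _) <= _).
  by rewrite [LHS]complex_ReIm /= mulrC.
clearbody rho K.
have th0 : 0 < theta := lt_trans (expR_gt0 _) sth.
pose L := ln theta; have sL : s < L by rewrite -[s]expRK ltr_ln ?posrE ?expR_gt0.
have lK0 : 0 <= ln K by rewrite ln_ge0.
(* N is about eta * 2j ln j.  The factor K ^ N then moves the exponent s at most
   half of the way up to L = ln theta. *)
pose eta := (L - s) / (2 * (ln K + 1)).
have eta0 : 0 < eta by rewrite divr_gt0 ?mulr_gt0 //; lra.
have etaK : eta * ln K <= (L - s) / 2.
  rewrite /eta mulrAC ler_pdivrMr ?mulr_gt0 //; last by lra.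
  rewrite [leRHS](_ : _ = (L - s) * (ln K + 1)); last by field.
  by rewrite ler_wpM2l; lra.
have ln2 : 0 < ln 2 :> R by rewrite ln_gt0 // ltr1n.
(* The gain 2 ^ (- N) lowers an exponent by eta * ln 2, so half of that is allowed
   above L. *)
pose sg := L + eta * ln 2 / 2.
have eln2 : 0 < eta * ln 2 by rewrite mulr_gt0.
have [c1 [k1 Hlb]] : exists c1 k1, forall n z, modulus z <= modulus x%:C + (r + rho) ->
    modulus (D n z) <= expR (c1 + k1 * n%:R + sg * nlogn R n).
  apply: (log_bounded_of_theta eg (s := sg)).
    by rewrite -/theta -[X in X < _](lnK (x := theta)) ?posrE // ltr_expR /sg /L; lra.
  by rewrite addr_ge0 ?modulus_ge0 // addr_ge0 ?ltW.
have [k2 Hk2] := nlogn_le_nlogn2 c1 k1 sg (leqW b1).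
pose s' := Num.max ((s + L) / 2) (L - eta * ln 2 / 2).
have s'L : s' < L by rewrite gt_max; lra.
have s'1 : (s + L) / 2 <= s' by rewrite le_max lexx.
have s'2 : L - eta * ln 2 / 2 <= s' by rewrite le_max lexx orbT.
pose k3 := ln K + `|k2| + 2.
have sgE : sg = L + eta * ln 2 / 2 by [].
have LE : L = ln theta by [].
clearbody s' sg eta L.
have main j w : (0 < j)%N -> (J <= j)%N -> modulus w <= r ->
    modulus (D (j.*2 + b) (x%:C + w)) <= expR (k3 * j%:R + s' * nlogn2 R j).
  move=> j0 Jj wr; have j1 : 1 <= j%:R :> R by rewrite ler1n.
  have Hk2j := Hk2 j j0; have twocj := fun A N => @twoc j w A N.
  have : 0 <= nlogn2 R j by rewrite /nlogn2 mulr_ge0 ?ler0n // ln_ge0.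
  move: Hk2j twocj; move: (nlogn2 R j) => X Hk2j twocj X0.
  have [N [N0 N1 N2]] : exists N, [/\ (0 < N)%N, eta * X <= N%:R & N%:R <= eta * X + 1].
    exists (Num.truncn (eta * X)).+1; split => //.
      by rewrite ltW // truncnS_gt.
    by rewrite -natr1 lerD2r truncn_le mulr_ge0 // ltW.
  apply: le_trans (twocj (expR (k2 * j%:R + sg * X)) N N0 Jj wr _) _.
    move=> z hz; apply: le_trans (Hlb _ _ _) _.
      rewrite -(subrK x%:C z) addrC; apply: le_trans (modulusD _ _) _.
      by rewrite lerD2l.
    by rewrite ler_expR.
  have KN : K ^+ N <= expR (ln K * (eta * X + 1)).
    rewrite -{1}(lnK (x := K)) ?posrE; last by lra.
    by rewrite -expRM_natl mulrC ler_expR ler_wpM2l.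
  have hN : 2^-1 ^+ N <= expR (- (ln 2 * (eta * X))).
    rewrite -[2^-1](lnK (x := 2^-1)) ?posrE ?invr_gt0 // lnV ?posrE //.
    by rewrite -expRM_natl ler_expR mulrN lerN2 mulrC ler_wpM2r // ltW.
  have P1 : K ^+ N * expR (s * X) <= expR (ln K + `|k2| * j%:R + s' * X).
    apply: le_trans (ler_wpM2r (expR_ge0 _) KN) _; rewrite -expRD ler_expR.
    have h1 : eta * ln K * X <= (L - s) / 2 * X by rewrite ler_wpM2r.
    have h2 : (s + L) / 2 * X <= s' * X by rewrite ler_wpM2r.
    have h3 : 0 <= `|k2| * j%:R by rewrite mulr_ge0.
    lra.
  have P2 : expR (k2 * j%:R + sg * X) * 2^-1 ^+ N <= expR (ln K + `|k2| * j%:R + s' * X).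
    apply: le_trans (ler_wpM2l (expR_ge0 _) hN) _; rewrite -expRD ler_expR.
    have h1 : k2 * j%:R <= `|k2| * j%:R by rewrite ler_wpM2r ?ler_norm.
    have h2 : (L - eta * ln 2 / 2) * X <= s' * X by rewrite ler_wpM2r.
    rewrite sgE; lra.
  rewrite -mulrA.
  have e2 : 3 <= expR 2 :> R by have := expR_ge1Dx (2 : R); lra.
  apply: (@le_trans _ _ (expR 2 * expR (ln K + `|k2| * j%:R + s' * X))).
    apply: (@le_trans _ _ (3 * expR (ln K + `|k2| * j%:R + s' * X))); first by lra.
    by rewrite ler_wpM2r ?expR_ge0.
  rewrite -expRD ler_expR.
  have h1 : ln K <= ln K * j%:R by rewrite ler_peMr.
  rewrite /k3; lra.
pose J' := maxn J 1.
have bound0 j : (J' <= j)%N -> modulus (D (j.*2 + b) x%:C) <= expR (k3 * j%:R + s' * nlogn2 R j).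
  rewrite geq_max => /andP[Jj j0]; rewrite -[x%:C]addr0; apply: main => //.
  by rewrite modulus0 ltW.
have bound1 j : (J' <= j)%N -> modulus (D (j.*2 + b.+1) x%:C) <= expR (k3 * j%:R + s' * nlogn2 R j).
  rewrite geq_max => /andP[Jj j0]; rewrite addnS -[leRHS]divr1.
  apply: (cauchy_estimate (@dD (j.*2 + b))) => // z zx.
  by rewrite -[z](subrKC x%:C); apply: main; rewrite // zx.
have [k4 Hk4] := nlogn2_le_nlogn k3 s' (leqW b1).
have [k5 Hk5] := nlogn2_le_nlogn k3 s' (b1 : (b.+1 <= 2)%N).
suff : theta <= expR s'.
  by rewrite leNgt -[X in _ < X](lnK (x := theta)) ?posrE // ltr_expR -LE s'L.
apply: (@theta_le_of_log_bounded R g eg (J'.*2 + b) x%:C 0 (Num.max k4 k5) s') => n nJ.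
pose j := (n - b)./2.
have bn : (b <= n)%N by apply: leq_trans nJ; rewrite leq_addl.
have J'j : (J' <= j)%N by rewrite /j -(doubleK J') half_leq // leq_subRL // addnC.
have j0 : (0 < j)%N by apply: leq_trans J'j; rewrite leq_max orbT.
have nE : n = (odd (n - b) + (j.*2 + b))%N by rewrite addnA odd_double_half subnK.
rewrite add0r nE; case: (odd (n - b)); rewrite ?add0n ?add1n -?addnS.
  apply: le_trans (bound1 j J'j) _; rewrite ler_expR.
  apply: le_trans (Hk5 j j0) _; rewrite lerD2r ler_wpM2r ?ler0n //.
  by rewrite le_max lexx orbT.
apply: le_trans (bound0 j J'j) _; rewrite ler_expR.
apply: le_trans (Hk4 j j0) _; rewrite lerD2r ler_wpM2r ?ler0n //.
by rewrite le_max lexx.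
Qed.

End Slices.

(** * Almost every point *)

Section AlmostEverywhere.
Variable R : realType.
Local Notation mu := (@lebesgue_measure R).

(** The complement is open, hence a countable union of rectangles with rational
    data. *)
Lemma measurable_modulus_le (f f' : R[i] -> R[i]) (c : R) :
  (forall z, cdiff f z (f' z)) ->
  measurable [set p : R * R | modulus (f (p.1 +i* p.2)) <= c].
Proof.
move=> df; rewrite -[X in measurable X]setCK; apply: measurableC.
set U := ~` _.
pose box (q : rat * rat * nat) : set (R * R) :=
  `]ratr q.1.1 - q.2.+1%:R^-1, ratr q.1.1 + q.2.+1%:R^-1[%classic `*`
  `]ratr q.1.2 - q.2.+1%:R^-1, ratr q.1.2 + q.2.+1%:R^-1[%classic.
pose F n : set (R * R) := if unpickle n is Some q then
  if `[< box q `<=` U >] then box q else set0 else set0.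
suff -> : U = \bigcup_n F n.
  apply: bigcup_measurable => n _; rewrite /F.
  case: (unpickle n) => [q|] //; case: ifP => // _.
  by apply: measurableX; exact: measurable_itv.
apply/seteqP; split => p; last first.
  by move=> [n _]; rewrite /F; case: (unpickle n) => [q|] //; case: asboolP => // bU /bU.
case: p => x y; rewrite /U /= => /negP; rewrite -ltNge => cf.
set z := x +i* y in cf.
have e0 : 0 < (modulus (f z) - c) / 2 by rewrite divr_gt0 // subr_gt0.
have [r r0 Hr] := cdiff_cont (df z) e0.
pose k := Num.truncn (4 / r); pose d : R := k.+1%:R^-1.
have d0 : 0 < d by rewrite invr_gt0 ltr0n.
have dr : d < r / 4.
  rewrite /d invf_plt ?posrE ?divr_gt0 ?ltr0n // invf_div; exact: truncnS_gt.
have near (a : R) : exists q : rat, ratr q - d < a < ratr q + d.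
  have [q] := @rat_in_itvoo R (a - d) (a + d) ltac:(lra).
  by rewrite in_itv /= => hq; exists q; lra.
have [q1 h1] := near x; have [q2 h2] := near y.
have [n Fn] : exists n, F n = if `[< box (q1, q2, k) `<=` U >] then box (q1, q2, k) else set0.
  by exists (pickle (q1, q2, k)); rewrite /F pickleK.
exists n; first by [].
rewrite Fn {F Fn n}.
case: asboolP => [_|]; first by split; rewrite /= in_itv.
case=> -[u v] [/=]; rewrite !in_itv /= -/d => hu hv; apply/negP; rewrite -ltNge.
have close : modulus (u +i* v - z) < r.
  apply: (@le_lt_trans _ _ (2 * d + 2 * d)); last by lra.
  by apply: modulus_le_box (lexx _); rewrite /= ler_norml; lra.
have := Hr _ close; rewrite subrKC => A.
have B := modulus_sub_ge (f z) (f z - f (u +i* v)).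
rewrite subKr (modulusB (f z)) in B.
lra.
Qed.

Variable g : R[i] -> R[i].
Hypothesis eg : entire g.
Let theta := theta_of_order (order_entire g).

(** The exceptional set is a countable union of such sets.  The bound [r] on the
    ordinate makes their vertical slices bounded. *)
Definition small_set (b : nat) (s : R) (J : nat) (r : R) : set (R * R) :=
  [set p | `|p.2| <= r /\ forall j, (J <= j)%N ->
    modulus (cderiv (j.*2 + b) g (p.1 +i* p.2)) <= expR (s * nlogn2 R j)].

Lemma small_set_measurable b s J r : measurable (small_set b s J r).
Proof.
pose A j := [set p : R * R | modulus (cderiv (j.*2 + b) g (p.1 +i* p.2)) <= expR (s * nlogn2 R j)].
have -> : small_set b s J r = (setT `*` `[- r, r]%classic) `&` \bigcap_(j in [set j | (J <= j)%N]) A j.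
  apply/seteqP; split => p [/= h1 h2].
    by split; [split => //=; rewrite in_itv /= -ler_norml|exact: h2].
  by case: h1 => _ /=; rewrite in_itv /= -ler_norml.
apply: measurableI.
  by apply: measurableX; [exact: measurableT|exact: measurable_itv].
apply: bigcap_measurable; first by exists J => /=.
move=> j _.
exact: (measurable_modulus_le _ (cdiff_cderiv eg (j.*2 + b))).
Qed.

Lemma small_set_null b s J r : (b <= 1)%N -> expR s < theta -> 1 <= r ->
  (mu \x mu)%E (small_set b s J r) = 0.
Proof.
move=> b1 sth r1; have mS := small_set_measurable b s J r.
apply: integral0_eq => x _ /=.
have mE := measurable_xsection x mS.
have xE : xsection (small_set b s J r) x = [set y | `|y| <= r /\
    forall j, (J <= j)%N -> modulus (cderiv (j.*2 + b) g (x +i* y)) <= expR (s * nlogn2 R j)].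
  by apply/seteqP; split => y; rewrite /xsection /= ?inE.
by rewrite xE in mE *; exact: (slice_null eg b1 sth r1 mE).
Qed.

Lemma theta_pairE b (z : R[i]) : (b <= 1)%N ->
  (forall (q : rat) J (r : nat), expR (ratr q) < theta ->
     ~ small_set b (ratr q) J r.+1%:R (complex.Re z, complex.Im z)) ->
  limn_esup (fun j => (modulus (cderiv (j.*2 + b) g z) `^ (nlogn2 R j)^-1)%:E) = theta%:E.
Proof.
move=> b1 H; apply: ereal_squeeze.
- exact: limn_esup_powR_ge0.
- exact: theta_pair_le.
- move=> s sth /limn_esup_lt[N HN].
  have th0 : 0 < theta := lt_trans (expR_gt0 _) sth.
  have sth' : s < ln theta by rewrite -[s]expRK ltr_ln ?posrE ?expR_gt0.
  have [q] := rat_in_itvoo sth'; rewrite in_itv /= => /andP[sq qth].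
  have [N' HN'] := @nlogn2_dominates R 0 s (ratr q) sq.
  apply: (H q (maxn N N') (Num.truncn `|complex.Im z|)).
    by rewrite -[X in _ < X](lnK (x := theta)) ?posrE // ltr_expR.
  split; first by rewrite /= ltW // truncnS_gt.
  move=> j /=; rewrite geq_max => /andP[/HN A /HN'[j0 E0 B]].
  case: z A {H HN} => x y /= A.
  rewrite -powR_root_leE ?modulus_ge0 //; apply: le_trans (ltW _) _; first exact: A.
  by rewrite ler_expR ltW.
Qed.

Lemma ae_theta_pair : ae_complex (fun z : R[i] => forall b, (b <= 1)%N ->
  limn_esup (fun j => (modulus (cderiv (j.*2 + b) g z) `^ (nlogn2 R j)^-1)%:E) = theta%:E).
Proof.
pose P (n : nat) (p : R * R) := if unpickle n is Some ((b, q), (J, r)) then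
  ((b : nat) <= 1)%N -> expR (ratr (q : rat)) < theta -> ~ small_set b (ratr q) (J : nat) (r : nat).+1%:R p
  else True.
have : {ae (mu \x mu)%E, forall p : R * R, forall n, P n p}.
  apply: ae_foralln => n; rewrite /P.
  case: (unpickle n) => [[[b q] [J r]]|]; last by apply: aeW.
  have [b1|b1] := leqP b 1; last exact: aeW.
  have [qth|qth] := ltP (expR (ratr q)) theta; last exact: aeW.
  exists (small_set b (ratr q) J r.+1%:R); split.
  - exact: small_set_measurable.
  - by apply: small_set_null => //; rewrite ler1n.
  - by move=> p /= /not_implyP[_] /not_implyP[_] /contrapT.
apply: negligibleS => p /= nQ Hp; apply: nQ => b b1.
apply: theta_pairE => // q J r qth.
have := Hp (pickle ((b, q), (J, r))); rewrite /P pickleK => /(_ b1 qth).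
by case: p {Hp}.
Qed.

End AlmostEverywhere.

Theorem theorem1 (R : realType) (g : R[i] -> R[i]) (g_entire : entire g)
    (theta : R) (theta_def : theta = theta_of_order (order_entire g)) :
  (forall z : R[i], theta_all g z = theta%:E) /\
  ae_complex (fun z : R[i] => theta_even g z = theta%:E /\
                              theta_odd g z = theta%:E).
Proof.
rewrite theta_def; split; first by move=> z; exact: theta_allE.
have := ae_theta_pair g_entire; rewrite /ae_complex.
apply: negligibleS => p /= nQ Hp; apply: nQ; split.
  rewrite -(Hp 0%N isT) /theta_even; congr limn_esup; apply/funext => j.
  by rewrite addn0.
rewrite -(Hp 1%N isT) /theta_odd; congr limn_esup; apply/funext => j.
by rewrite addn1.
Qed.
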